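(* Let $1\le k\le n-1$ and let $q$ be a power of an odd prime with $\sqrt{-1}\in\mathbb{F}_q$. Then $$|\mathrm{Gr}(k,n)_{\mathbb{F}_q}|=\pm\, q^{k(n-k)-D}\,p_{(k,n)}(q),\qquad D=\deg(p_{(k,n)}(q)).$$
   Context: $\mathrm{Gr}(k,n)_{\mathbb{F}_q}$ is the set of $\mathbb{F}_q$-points (subspaces defined over $\mathbb{F}_q$) of $\mathrm{Gr}(k,n)_{\overline{\mathbb{F}}_q}$, the Zariski open subset of the Grassmannian $\mathrm{Gr}(k,n,\overline{\mathbb{F}}_q)$ of $k$-dimensional subspaces of $\overline{\mathbb{F}}_q^{\,n}$ given by the $\mathrm{SO}_n(\overline{\mathbb{F}}_q)$-orbit of the span of the first $k$ standard basis vectors, where $\mathrm{SO}_n$ is the special orthogonal group of the form $x_1^2+\cdots+x_n^2$ (equivalently, the subspaces on which the restriction of this form is nondegenerate). Definition of $p_{(k,n)}(q)$ (a polynomial in an indeterminate, whose degree is $D$, evaluated at the prime power $q$): let $\mathcal{S}_n^{(k)}$ be the set of minimal length representatives of $\mathcal{S}_n/\langle s_i:i\neq k\rangle$, identified with the Schubert symbols $\sigma=(\sigma_1,\ldots,\sigma_k)$, $1\le\sigma_1<\cdots<\sigma_k\le n$; the length of the element $w_\sigma$ is $l(w_\sigma)=\sum_{i=1}^k(\sigma_i-i)$, and $e=(1,2,\ldots,k)$. Define signs $\epsilon_i=(-1)^{\lfloor i/2\rfloor}$ if $k$ is odd and $\epsilon_i=(-1)^{\lfloor(i-1)/2\rfloor}$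 if $k$ is even ($1\le i\le n$), and $\epsilon(\sigma)=\prod_{i=1}^k\epsilon_{\sigma_i}$. Whenever $\sigma'$ is obtained from $\sigma$ by replacing one entry $\sigma_i$ by $\sigma_i+1$ (the result again being a Schubert symbol), write $\sigma\Rightarrow\sigma'$ if $\epsilon(\sigma)=\epsilon(\sigma')$ and $\sigma\to\sigma'$ if $\epsilon(\sigma)=-\epsilon(\sigma')$. Let $\eta$ be the unique function on the Schubert symbols such that (i) $\eta(e)=0$; (ii) $\eta(\sigma')=\eta(\sigma)$ if $\sigma\Rightarrow\sigma'$; (iii) $\eta(\sigma')=\eta(\sigma)+1$ if $\sigma\to\sigma'$. Then $$p_{(k,n)}(q)=\sum_{w\in\mathcal{S}_n^{(k)}}(-1)^{l(w)}q^{\eta(w)}.$$ *)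

(* Defs.v *)
From HB Require Import structures.
From mathcomp Require Import all_boot all_order all_algebra.
From mathcomp Require Import boolp.

Set Implicit Arguments.
Unset Strict Implicit.
Unset Printing Implicit Defensive.

Import Order.TTheory GRing.Theory Num.Theory.
Local Open Scope ring_scope.

(* [SO g]: g is in the special orthogonal group of x_1^2 + ... + x_n^2, whose
   Gram matrix in the standard basis is 1%:M; row vectors, v |-> v *m g. *)
Definition SO (K : fieldType) (n : nat) (g : 'M[K]_n) : Prop :=
  g *m g^T = 1%:M /\ \det g = 1.

(* The row space of [pid_mx k] is spanned by the first k standard basis
   vectors. *)
Definition in_SO_orbit (K : fieldType) (k m n : nat) (A : 'M[K]_(m, n)) :
    Prop :=
  exists2 g : 'M[K]_n, SO g & (A == (pid_mx k : 'M[K]_n) *m g)%MS.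

(* A subspace of K^n defined over F is the extension of scalars of a unique
   subspace of F^n, and the latter is the row space of a unique A : 'M[F]_n
   such that <<A>> = A. *)
Definition Gr_points (F : finFieldType) (K : fieldType)
    (iota : {rmorphism F -> K}) (k n : nat) : {set 'M[F]_n} :=
  [set A : 'M[F]_n |
    (<<A>>%MS == A) && `[< in_SO_orbit k (map_mx iota A) >]].

(* Schubert symbols are 0-based here: for i : 'I_k and s : schubert k n,
   [s i] is sigma_(i+1) - 1. *)
Definition schubert (k n : nat) :=
  {f : {ffun 'I_k -> 'I_n} |
    [forall i : 'I_k, forall j : 'I_k, (i < j)%N ==> (f i < f j)%N]}.

Definition entry (k n : nat) (s : schubert k n) (i : 'I_k) : 'I_n := val s i.

Definition is_e (k n : nat) (s : schubert k n) : Prop :=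
  forall i : 'I_k, entry s i = i :> nat.

(* No truncation occurs in the subtraction: i <= entry s i. *)
Definition len (k n : nat) (s : schubert k n) : nat :=
  (\sum_(i < k) (entry s i - i))%N.

(* The index i of [epsi k i] is the 1-based one. *)
Definition epsi (k i : nat) : int :=
  if odd k then (-1) ^+ i./2 else (-1) ^+ (i.-1)./2.

Definition eps (k n : nat) (s : schubert k n) : int :=
  \prod_(i < k) epsi k (entry s i).+1.

Definition step (k n : nat) (s t : schubert k n) : Prop :=
  exists i : 'I_k, entry t i = (entry s i).+1 :> nat /\
    forall j : 'I_k, j != i -> entry t j = entry s j.

Definition double_arrow (k n : nat) (s t : schubert k n) : Prop :=
  step s t /\ eps s = eps t.

Definition single_arrow (k n : nat) (s t : schubert k n) : Prop :=
  step s t /\ eps s = - eps t.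

Definition eta_spec (k n : nat) (f : schubert k n -> nat) : Prop :=
  [/\ forall s, is_e s -> f s = 0%N,
      forall s t, double_arrow s t -> f t = f s
    & forall s t, single_arrow s t -> f t = (f s).+1].

Section EtaExistence.
Variables k n : nat.
Implicit Types s t : schubert k n.

Lemma entry_lt s (i j : 'I_k) : (i < j)%N -> (entry s i < entry s j)%N.
Proof. by move=> ij; have /forallP/(_ i)/forallP/(_ j)/implyP := valP s; apply. Qed.

Lemma entry_ge s (i : 'I_k) : (i <= entry s i)%N.
Proof.
case: i => i; elim: i => [//|i IH] Hi.
have Hi' : (i < k)%N by apply: ltnW.
by apply: leq_ltn_trans (IH Hi') _; apply: entry_lt.
Qed.

Lemma entry_le s (i : 'I_k) : (entry s i + (k - i) <= n)%N.
Proof.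
have [d] := ubnP (k - i); elim: d i => [//|d IH] i Hd.
case: (ltnP i.+1 k) => Hi.
  have := IH (Ordinal Hi); rewrite /= subnS.
  have -> : ((k - i).-1 < d)%N by rewrite -ltnS prednK // subn_gt0.
  move=> /(_ isT); apply: leq_trans.
  have := @entry_lt s i (Ordinal Hi) (ltnSn i).
  have := ltn_ord i; rewrite -subn_gt0; case: (k - i)%N => //= m _ H.
  by rewrite addnS -addSn leq_add2r.
have -> : (k - i = 1)%N.
  by apply/eqP; rewrite eqn_leq subn_gt0 ltn_ord leq_subLR addn1 Hi.
by rewrite addn1.
Qed.

Lemma epsiE i : (epsi k i == 1) || (epsi k i == -1).
Proof.
rewrite /epsi; case: ifP => _; rewrite -signr_odd; case: (odd _);
by rewrite ?expr0 ?expr1 eqxx ?orbT.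
Qed.

Lemma epsE s : (eps s == 1) || (eps s == -1).
Proof.
rewrite /eps; elim/big_rec: _ => [|i x _]; first by rewrite eqxx.
by case/orP: (epsiE (entry s i).+1) => /eqP-> /orP[] /eqP->.
Qed.

Let chg (a : nat) : bool := epsi k a.+1 != epsi k a.+2.
Let eta0 s : nat := (\sum_(i < k) \sum_(i <= a < entry s i) chg a)%N.

Let eta0_step s t (i : 'I_k) : entry t i = (entry s i).+1 :> nat ->
  (forall j : 'I_k, j != i -> entry t j = entry s j) ->
  eta0 t = (eta0 s + (eps s != eps t))%N.
Proof.
move=> ti tj; rewrite /eta0 (bigD1 i) //= [in RHS](bigD1 i) //= ti.
rewrite big_nat_recr ?entry_ge //= -!addnA; congr addn.
rewrite addnC; congr addn; first by apply: eq_bigr => j /tj ->.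
rewrite /eps (bigD1 i) //= [in X in _ = nat_of_bool (_ != X)](bigD1 i) //= ti.
set x := \prod_(j | j != i) _; set y := \prod_(j | j != i) _.
have <- : x = y by apply: eq_bigr => j /tj ->.
have x0 : x != 0.
  apply/prodf_neq0 => j _.
  by case/orP: (epsiE (entry s j).+1) => /eqP->.
by rewrite (inj_eq (mulIf x0)).
Qed.

Lemma eta_exists : exists f : schubert k n -> nat, eta_spec f.
Proof.
exists eta0; split.
- move=> s es; rewrite /eta0 big1 // => i _.
  by rewrite big_geq // es.
- by move=> s t [[i [ti tj]] e]; rewrite (eta0_step ti tj) e eqxx addn0.
- move=> s t [[i [ti tj]] e]; rewrite (eta0_step ti tj) e.
  by case/orP: (epsE t) => /eqP->; rewrite addn1.
Qed.

Lemma step_exists s : ~ is_e s -> exists t, step t s.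
Proof.
move=> nes.
have [i0 Hi0] : exists i : 'I_k, entry s i != i :> nat.
  apply: contrapT => H; apply: nes => i; apply/eqP/negPn/negP => Hi.
  by apply: H; exists i.
case: (@arg_minnP _ i0 (fun i : 'I_k => entry s i != i :> nat) val Hi0) =>
  i Hi imin.
have si : (i < entry s i)%N by rewrite ltn_neqAle eq_sym Hi entry_ge.
have Hp : ((entry s i).-1 < n)%N.
  exact: leq_ltn_trans (leq_pred _) (ltn_ord _).
pose f := [ffun j : 'I_k => if j == i then Ordinal Hp else entry s j].
have fP : [forall i : 'I_k, forall j : 'I_k, (i < j)%N ==> (f i < f j)%N].
  apply/forallP => a; apply/forallP => b; apply/implyP => ab; rewrite !ffunE.
  case: eqP => [ai|_]; case: eqP => [bi|_].
  - by rewrite ai bi ltnn in ab.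
  - rewrite ai in ab; apply: leq_ltn_trans (leq_pred _) _.
    exact: entry_lt.
  - rewrite bi in ab; have /eqP -> : entry s a == a :> nat.
      by apply: contraLR ab => /imin; rewrite -leqNgt.
    rewrite /= -ltnS prednK; first exact: leq_ltn_trans si.
    exact: leq_trans si.
  - exact: entry_lt.
exists (exist _ f fP), i; split.
  by rewrite [in RHS]/entry /= ffunE eqxx /= prednK //; exact: leq_trans si.
by move=> j /negbTE ji; rewrite [in RHS]/entry /= ffunE ji.
Qed.

Lemma len_step s t : step s t -> len t = (len s).+1.
Proof.
case=> i [ti tj]; rewrite /len (bigD1 i) //= [in RHS](bigD1 i) //= ti.
rewrite subSn ?entry_ge // addSn; congr (_ + _).+1.
by apply: eq_bigr => j /tj ->.
Qed.

Lemma eta_unique (f g : schubert k n -> nat) :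
  eta_spec f -> eta_spec g -> f =1 g.
Proof.
move=> [f0 f1 f2] [g0 g1 g2] s.
have [d] := ubnP (len s); elim: d s => [//|d IH] s Hd.
have [es|/step_exists[t st]] := pselect (is_e s); first by rewrite f0 ?g0.
have IHt : f t = g t by apply: IH; rewrite (len_step st) in Hd.
have [e|e] : eps t = eps s \/ eps t = - eps s.
  by case/orP: (epsE t) => /eqP->; case/orP: (epsE s) => /eqP->; by [left|right].
- by rewrite (f1 t) // (g1 t).
- by rewrite (f2 t) // (g2 t) // IHt.
Qed.

Definition eta : schubert k n -> nat := sval (cid eta_exists).

Lemma etaP : eta_spec eta.
Proof. exact: svalP (cid eta_exists). Qed.

Lemma eta_le s : (eta s <= k * (n - k))%N.
Proof.
have le_len : (eta s <= len s)%N.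
  have [f0 f1 f2] := etaP.
  have [m] := ubnP (len s); elim: m s => [//|m IH] s Hm.
  have [es|/step_exists[t st]] := pselect (is_e s); first by rewrite f0.
  have IHt : (eta t <= len t)%N by apply: IH; rewrite (len_step st) in Hm.
  rewrite (len_step st).
  have [e|e] : eps t = eps s \/ eps t = - eps s.
    by case/orP: (epsE t) => /eqP->; case/orP: (epsE s) => /eqP->; by [left|right].
  - by rewrite (f1 t) //; exact: leqW.
  - by rewrite (f2 t).
apply: leq_trans le_len _.
rewrite -[X in (_ <= X * _)%N]card_ord -sum_nat_const; apply: leq_sum => i _.
have <- : (entry s i + (k - i) - k = entry s i - i)%N.
  by rewrite -[X in (_ - X)%N](subnKC (ltnW (ltn_ord i))) subnDr.
exact/leq_sub2r/entry_le.
Qed.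

End EtaExistence.

Definition p_poly (k n : nat) : {poly int} :=
  \sum_(s : schubert k n) (-1) ^+ len s *: 'X^(eta s).

(* So the natural-number subtraction in the exponent k(n-k) - D is exact. *)
Lemma deg_p_poly (k n : nat) : ((size (p_poly k n)).-1 <= k * (n - k))%N.
Proof.
rewrite -subn1 leq_subLR add1n; apply: leq_trans (size_sum _ _ _) _.
apply/bigmax_leqP => s _; apply: leq_trans (size_scale_leq _ _) _.
by rewrite size_polyXn ltnS eta_le.
Qed.

(* Main.v *)
Require Import Defs.
From mathcomp Require Import all_boot all_order all_algebra.
From mathcomp Require Import boolp.
From mathcomp Require Import ring zify.

Set Implicit Arguments.
Unset Strict Implicit.
Unset Printing Implicit Defensive.

Import GRing.Theory Num.Theory.
Local Open Scope ring_scope.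

(** Over an algebraically closed field of characteristic different from 2, a
    subspace lies in the orbit exactly when the form is nondegenerate on it: an
    orthonormal basis of the subspace extends to an orthonormal basis of the
    whole space, and the sign of the determinant can be corrected inside the
    subspace.  So the points to count are the nondegenerate k-dimensional
    subspaces of F^n.  On each of them the form is isometric to
    diag(1, ..., 1, d), where d is 1 or a fixed nonsquare nu
    ([classification]), and this sorts the points into two types
    ([Gr_points_framed]).

    The points of type d number #{X | X X^T = D} / #{P | P D P^T = D}, with
    D = diag(1, ..., 1, d) ([card_framed]).  Both sets have the form
    {X | X H X^T = G} and are counted one row at a time: reflections make the
    isometry group of H transitive on the vectors of norm 1, so the first row
    can be chosen freely among these vectors and then split off
    ([card_frames_peel]).  This leaves the number of vectors of a given norm.
    Since -1 is a square, x^2 + y^2 is a product of two independent linear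
    forms, which gives a recursion in steps of two dimensions
    ([card_norm_hyperbolic]).  The numbers of unit vectors in dimensions 2j and
    2j+1 have product q^(2j-1) (q^(2j) - 1), and after this pairing the sum over
    the two types takes a closed form (the lemmas [framed_count_*]).

    On the other side, (-1)^l(sigma) q^eta(sigma) is the product over i of
    w(sigma_i) / w(i), where w runs through 1, -1, q, -q, q^2, ... for k even
    and through 1, -q, q, -q^2, q^2, ... for k odd ([weight_eq]).  Hence p is,
    up to the factor w(0) ... w(k-1), the k-th elementary symmetric polynomial
    of the first n weights ([p_poly_elsym]).  Opposite weights cancel in
    pairs, (1 - w Y) (1 + w Y) = 1 - w^2 Y^2, and the q-binomial theorem with
    base q^2 evaluates the result ([elsym_pair_wt]): p is a Gaussian binomial
    coefficient in q^2, times 1 - q^(n/2) when k is odd and n is even.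

    The count and p(q) are thus the same Gaussian binomial up to explicit
    factors, and the degree of p identifies the remaining power of q
    ([count_of_qprod_identities]). *)

Local Notation dsum A B := (block_mx A 0 0 B).

(** * Isometries and frames *)

Lemma dsum_sym (R : pzSemiRingType) m n (A : 'M[R]_m) (B : 'M[R]_n) :
  A^T = A -> B^T = B -> (dsum A B)^T = dsum A B.
Proof. by move=> sA sB; rewrite tr_block_mx !trmx0 sA sB. Qed.

Lemma one_dsum (R : pzSemiRingType) n :
  1%:M = dsum (1%:M : 'M_1) (1%:M : 'M_n) :> 'M[R]_(1 + n).
Proof. exact: scalar_mx_block. Qed.

Lemma congr_dsum (R : comPzRingType) k n (a : R) (H : 'M[R]_n) (Y : 'M_(k, n)) :
  dsum (1%:M : 'M_1) Y *m dsum a%:M H *m (dsum 1%:M Y)^T =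
  dsum a%:M (Y *m H *m Y^T).
Proof.
rewrite tr_block_mx !trmx0 trmx1 !mulmx_block.
by rewrite !(mulmx0, mul0mx, mulmx1, mul1mx, addr0, add0r).
Qed.

Section Isometries.
Variable K : fieldType.

(** The map x |-> x - 2 (x,w)/(w,w) w, for the form H on row vectors. *)
Lemma reflection n (H : 'M[K]_n) (w : 'rV_n) (c : K) :
    H^T = H -> w *m H *m w^T = c%:M -> c != 0 ->
  let g := 1%:M - (2%:R / c) *: (H *m w^T *m w) in
  g *m g = 1%:M /\ g *m H *m g^T = H.
Proof.
move=> sH wc c0 /=; set t := 2%:R / c.
have tc : t * c = 2%:R by rewrite divfK.
have sq : H *m w^T *m w *m (H *m w^T *m w) = c *: (H *m w^T *m w).
  by rewrite -!mulmxA (mulmxA w) (mulmxA (w *m H)) wc mul_scalar_mx -!scalemxAr.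
have sw : H *m w^T *m w *m H *m (H *m w^T *m w)^T = c *: (H *m w^T *m w *m H).
  rewrite !trmx_mul trmxK sH -!mulmxA (mulmxA w) (mulmxA (w *m H)) wc.
  by rewrite mul_scalar_mx -!scalemxAr.
split.
  rewrite mulmxBr mulmx1 mulmxBl mul1mx -scalemxAl -scalemxAr sq !scalerA.
  by rewrite -mulrA tc mulr_natr mulr2n scalerDl opprB addrK subrK.
rewrite mulmxBl mul1mx linearB /= trmx1 linearZ /= mulmxBr mulmx1.
rewrite mulmxBl -!scalemxAl -!scalemxAr sw.
have -> : H *m (H *m w^T *m w)^T = H *m w^T *m w *m H.
  by rewrite !trmx_mul trmxK sH !mulmxA.
by rewrite !scalerA -mulrA tc mulr_natr mulr2n scalerDl opprB addrK subrK.
Qed.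

Hypothesis two_neq0 : 2%:R != 0 :> K.

(** The reflection in e - v exchanges e and v, unless e - v is isotropic.  The
    norms of e - v and e + v add up to 4, so in that case the reflection in
    e + v exists; it takes e to -v, and its negative takes e to v. *)
Lemma isometry_transitive n (H : 'M[K]_n) (e v : 'rV_n) :
    H^T = H -> e *m H *m e^T = 1%:M -> v *m H *m v^T = 1%:M ->
  exists g, [/\ g *m g = 1%:M, g *m H *m g^T = H & e *m g = v].
Proof.
move=> sH e1 v1.
have [b eb] : exists b, e *m H *m v^T = b%:M by eexists; exact: mx11_scalar.
have vb : v *m H *m e^T = b%:M.
  by rewrite -[RHS]tr_scalar_mx -eb !trmx_mul trmxK sH mulmxA.
have [b1|b1] := eqVneq b 1.
  have wc : (e + v) *m H *m (e + v)^T = (4%:R)%:M.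
    rewrite linearD /= mulmxDr !mulmxDl e1 v1 eb vb b1.
    by rewrite -!raddfD /=; congr _%:M; ring.
  have c0 : 4%:R != 0 :> K by rewrite (natrM _ 2 2) mulf_neq0.
  have [gg gH] := reflection sH wc c0.
  set g := _ - _ in gg gH; exists (- g); split.
  - by rewrite mulNmx mulmxN opprK.
  - by rewrite mulNmx linearN /= mulmxN mulNmx opprK.
  have ew : e *m H *m (e + v)^T = (1 + 1)%:M.
    by rewrite linearD /= mulmxDr e1 eb b1 -raddfD.
  rewrite mulmxN mulmxBr mulmx1 -scalemxAr !mulmxA ew mul_scalar_mx scalerA.
  have -> : 2%:R / 4%:R * (1 + 1) = 1 :> K by field.
  by rewrite scale1r opprB addrC addKr.
have wc : (e - v) *m H *m (e - v)^T = (2%:R * (1 - b))%:M.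
  rewrite linearB /= mulmxBr !mulmxBl e1 v1 eb vb.
  by rewrite -!raddfB /=; congr _%:M; ring.
have b0 : 1 - b != 0 by rewrite subr_eq0 eq_sym.
have c0 : 2%:R * (1 - b) != 0 by rewrite mulf_neq0.
have [gg gH] := reflection sH wc c0.
set g := _ - _ in gg gH; exists g; split=> //.
have ew : e *m H *m (e - v)^T = (1 - b)%:M.
  by rewrite linearB /= mulmxBr e1 eb -raddfB.
rewrite mulmxBr mulmx1 -scalemxAr !mulmxA ew mul_scalar_mx scalerA.
have -> : 2%:R / (2%:R * (1 - b)) * (1 - b) = 1 :> K by field; rewrite b0.
by rewrite scale1r opprB addrC subrK.
Qed.

(** Orthogonality to the first row kills the first coordinate of every other
    row. *)
Lemma frame_peel k n (H : 'M[K]_n) (G : 'M_k) (X : 'M_(1 + k, 1 + n)) :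
    X *m dsum 1%:M H *m X^T = dsum 1%:M G -> usubmx X = row_mx 1%:M 0 ->
  exists2 Y : 'M_(k, n), Y *m H *m Y^T = G & X = dsum 1%:M Y.
Proof.
move=> + Xu; rewrite -[X]vsubmxK Xu -[dsubmx X]hsubmxK -block_mxEv.
move: (lsubmx _) (rsubmx _) => a Y.
rewrite tr_block_mx !mulmx_block.
rewrite !(trmx1, trmx0, mulmx0, mulmx1, mul0mx, mul1mx, addr0, add0r).
by case/eq_block_mx=> _ _ -> <-; exists Y; rewrite ?mul0mx ?add0r.
Qed.

Lemma first_row_norm n (H : 'M[K]_n) :
  row_mx 1%:M 0 *m dsum 1%:M H *m (row_mx 1%:M 0)^T = 1%:M :> 'M_1.
Proof.
rewrite tr_row_mx trmx1 trmx0 mul_row_block mul_row_col.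
by rewrite !(mulmx0, mulmx1, mul0mx, addr0).
Qed.

Lemma frame_first_row_norm k n (H : 'M[K]_n) (G : 'M_k) (X : 'M_(1 + k, n)) :
  X *m H *m X^T = dsum 1%:M G -> usubmx X *m H *m (usubmx X)^T = 1%:M.
Proof.
move=> XG; rewrite !mul_usub_mx trmx_usub mulmx_lsub XG.
by rewrite block_mxEh row_mxKl col_mxKu.
Qed.

(** Since g is an involution, it carries X back to a frame whose first row is
    the first basis vector. *)
Lemma frame_straighten k n (H : 'M[K]_n) (G : 'M_k) (g : 'M_(1 + n))
    (X : 'M_(1 + k, 1 + n)) :
    g *m g = 1%:M -> g *m dsum 1%:M H *m g^T = dsum 1%:M H ->
    row_mx 1%:M 0 *m g = usubmx X -> X *m dsum 1%:M H *m X^T = dsum 1%:M G ->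
  exists2 Y : 'M_(k, n), Y *m H *m Y^T = G & X = dsum 1%:M Y *m g.
Proof.
move=> gg gH Xu XG.
have [||Y YG XY] := @frame_peel k n H G (X *m g); last first.
- by exists Y; rewrite // -XY -mulmxA gg mulmx1.
- by rewrite -mul_usub_mx -Xu -mulmxA gg mulmx1.
by rewrite trmx_mul -!mulmxA (mulmxA g) (mulmxA (g *m _)) gH mulmxA.
Qed.

Lemma pid_mxS r m n :
  pid_mx r.+1 = dsum 1%:M (pid_mx r) :> 'M[K]_(1 + m, 1 + n).
Proof.
apply/matrixP=> i j; rewrite !mxE.
case: splitP => i' ->; rewrite !mxE; case: splitP => j' ->; rewrite !mxE ?ord1 //=.
Qed.

(** The isometry taking the first basis vector to the first row of Z reduces Z
    to an orthonormal family with one vector and one dimension less. *)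
Lemma orthonormal_extend k n (Z : 'M[K]_(k, n)) :
  Z *m Z^T = 1%:M -> exists2 g : 'M_n, g *m g^T = 1%:M & Z = pid_mx k *m g.
Proof.
elim: k n Z => [|k IH] [|n] Z ZZ.
- by exists 1%:M; rewrite ?trmx1 ?mulmx1 // [LHS]flatmx0 [RHS]flatmx0.
- by exists 1%:M; rewrite ?trmx1 ?mulmx1 // [LHS]flatmx0 [RHS]flatmx0.
- by move/matrixP/(_ 0 0)/eqP: ZZ; rewrite thinmx0 mul0mx !mxE eq_sym oner_eq0.
move: Z ZZ; rewrite -[k.+1]/(1 + k)%N -[n.+1]/(1 + n)%N => Z ZZ.
pose H := 1%:M : 'M[K]_n.
have sH : (dsum 1%:M H)^T = dsum 1%:M H :> 'M_(1 + n) by rewrite dsum_sym ?trmx1.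
have ZZ' : Z *m dsum 1%:M H *m Z^T = dsum (1%:M : 'M_1) (1%:M : 'M_k).
  by rewrite -!one_dsum mulmx1.
have [g [gg gH eg]] :=
  isometry_transitive sH (first_row_norm H) (frame_first_row_norm ZZ').
have [Y] := frame_straighten gg gH eg ZZ'.
rewrite mulmx1 => /IH[g' g'g' ->] ->; exists (dsum 1%:M g' *m g).
  rewrite trmx_mul -!mulmxA (mulmxA g).
  have -> : g *m g^T = 1%:M.
    by rewrite [RHS](one_dsum K n) -[RHS]gH -(one_dsum K n) mulmx1.
  rewrite mul1mx tr_block_mx !trmx0 trmx1 mulmx_block !mulmx0 !mul0mx mulmx1 g'g'.
  by rewrite !addr0 !add0r -one_dsum.
rewrite mulmxA; congr (_ *m g).
by rewrite pid_mxS mulmx_block !mulmx0 !mul0mx mulmx1 !addr0 !add0r.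
Qed.

End Isometries.

Definition frames (F : finNzRingType) k n (H : 'M[F]_n) (G : 'M[F]_k) :
    {set 'M[F]_(k, n)} :=
  [set X | X *m H *m X^T == G].

(** The first row of a frame is a vector of norm 1; by transitivity of the
    isometries, the frames with a given first row correspond to the frames of
    the complement H. *)
Lemma card_frames_peel (F : finFieldType) (two_neq0 : 2%:R != 0 :> F) k n
    (H : 'M[F]_n) (G : 'M[F]_k) : H^T = H ->
  #|frames (dsum (1%:M : 'M_1) H) (dsum (1%:M : 'M_1) G)| =
  (#|frames (dsum (1%:M : 'M_1) H) (1%:M : 'M_1)| * #|frames H G|)%N.
Proof.
move=> sH.
have sH1 : (dsum (1%:M : 'M_1) H)^T = dsum (1%:M : 'M_1) H :> 'M_(1 + n).
  by rewrite dsum_sym ?trmx1.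
rewrite -sum1_card.
rewrite (partition_big (fun X => usubmx X)
  (mem (frames (dsum (1%:M : 'M_1) H) 1%:M))) /=; last first.
  by move=> X; rewrite !inE => /eqP XG; rewrite (frame_first_row_norm XG).
rewrite -sum_nat_const; apply: eq_bigr => v; rewrite inE => /eqP v1.
have [g [gg gH eg]] := isometry_transitive two_neq0 sH1 (first_row_norm H) v1.
have inj : injective (fun Y : 'M_(k, n) => dsum (1%:M : 'M_1) Y *m g).
  move=> Y Y' /(congr1 (mulmx^~ g)); rewrite -!mulmxA gg !mulmx1.
  by case/eq_block_mx.
rewrite sum1dep_card -(card_imset _ inj); apply: eq_card => X; rewrite !inE.
apply/andP/imsetP => [[/eqP XG /eqP Xv]|[Y]].
  rewrite -Xv in eg; have [Y YG ->] := frame_straighten gg gH eg XG.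
  by exists Y; rewrite // inE YG.
rewrite inE => /eqP YG ->; split; apply/eqP.
  rewrite trmx_mul -!mulmxA (mulmxA g) (mulmxA (g *m _)) gH mulmxA.
  by rewrite congr_dsum YG.
by rewrite -mul_usub_mx block_mxEv col_mxKu.
Qed.

(** * Squares and vectors of given norm *)

Section Diag.
Variable R : pzRingType.
(** The form diag(1, ..., 1, d) in dimension k.+1.  With the 1s in front,
    [card_frames_peel] can be iterated. *)
Fixpoint diag_disc (d : R) k : 'M[R]_k.+1 :=
  if k is k'.+1 then block_mx (1%:M : 'M_1) 0 0 (diag_disc d k') else d%:M.

Lemma diag_discS d k :
  diag_disc d k.+1 = dsum (1%:M : 'M_1) (diag_disc d k).
Proof. by []. Qed.

Lemma diag_disc_sym d k : (diag_disc d k)^T = diag_disc d k.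
Proof.
elim: k => [|k IH]; first exact: tr_scalar_mx.
by apply: (@dsum_sym _ 1 k.+1) => //; exact: trmx1.
Qed.

Lemma diag_disc1 k : diag_disc 1 k = 1%:M.
Proof. by elim: k => [//|k IH]; rewrite diag_discS IH -one_dsum. Qed.

Lemma diag_discM a b k : diag_disc a k *m diag_disc b k = diag_disc (a * b) k.
Proof.
elim: k => [|k IH]; first by rewrite -scalar_mxM.
rewrite -[k.+2]/(1 + k.+1)%N !diag_discS.
by rewrite mulmx_block !mulmx0 !mul0mx mulmx1 IH !addr0 !add0r.
Qed.
End Diag.

Lemma det_diag_disc (R : comPzRingType) (d : R) k : \det (diag_disc d k) = d.
Proof.
elim: k => [|k IH]; first exact: det_scalar1.
rewrite diag_discS -[LHS]/(\det (block_mx _ _ _ _ : 'M_(1 + _))).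
by rewrite det_ublock det1 mul1r.
Qed.

Lemma scalar_mx1_inj (R : pzRingType) : injective (@scalar_mx R 1).
Proof. by move=> a b /matrixP/(_ 0 0); rewrite !mxE. Qed.

Section FiniteField.
Variable F : finFieldType.
Hypothesis two_neq0 : 2%:R != 0 :> F.
Local Notation q := #|F|.

Definition sqrt_count (t : F) : nat := #|[set x : F | x ^+ 2 == t]|.

Lemma sqrt_count_sqr x : x != 0 -> sqrt_count (x ^+ 2) = 2%N.
Proof.
move=> x0; rewrite /sqrt_count (_ : [set _ | _] = [set x; - x]).
  by rewrite cards2 -subr_eq0 opprK -mulr2n -mulr_natl mulf_neq0.
by apply/setP=> y; rewrite !inE eqf_sqr.
Qed.

Lemma sqrt_count0 : sqrt_count 0 = 1%N.
Proof.
rewrite /sqrt_count (_ : [set _ | _] = [set 0]) ?cards1 //.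
by apply/setP=> y; rewrite !inE sqrf_eq0.
Qed.

Lemma sqrt_count_nonsquare t : (forall x, x ^+ 2 != t) -> sqrt_count t = 0%N.
Proof.
by move=> Ht; apply: eq_card0 => x; rewrite inE (negbTE (Ht x)).
Qed.

Lemma sum_sqrt_count : (\sum_t sqrt_count t = q)%N.
Proof.
rewrite -[RHS]sum1_card [RHS](partition_big (fun x : F => x ^+ 2) xpredT) //=.
by apply: eq_bigr => t _; rewrite sum1dep_card.
Qed.

(** Squaring identifies 1 and -1, so on a finite set it cannot be onto. *)
Lemma nonsquare_exists : exists nu : F, forall x, x ^+ 2 != nu.
Proof.
have [/existsP[nu /forallP nuP]|all_sq] :=
  boolP [exists nu : F, forall x, x ^+ 2 != nu].
  by exists nu.
have sq t : exists x : F, x ^+ 2 == t.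
  move: all_sq; rewrite negb_exists => /forallP/(_ t).
  by rewrite negb_forall => /existsP[x /negPn]; exists x.
pose g t := xchoose (sq t).
have gK : cancel g (fun x => x ^+ 2) by move=> t; exact/eqP/(xchooseP (sq t)).
have [h _ hK] := injF_bij (can_inj gK).
have : h 1 = h (- 1) by rewrite -[h 1]gK -[h (- 1)]gK !hK sqrrN.
move/(congr1 g); rewrite !hK => /eqP.
by rewrite -subr_eq0 opprK (negbTE two_neq0).
Qed.

Section Nonsquare.
Variable nu : F.
Hypothesis nuP : forall x, x ^+ 2 != nu.

Lemma nu_neq0 : nu != 0.
Proof. by rewrite eq_sym; apply: contraNneq (nuP 0) => <-; rewrite expr0n. Qed.

(** If t is not 0, then t and nu t are not both squares, so the left-hand side
    is at most 2; its sum over t is twice the order of the field, which forces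
    equality for every t. *)
Lemma sqrt_count_nu t : (sqrt_count t + sqrt_count (nu * t)%R = 2)%N.
Proof.
have le2 s : (sqrt_count s + sqrt_count (nu * s)%R <= 2)%N.
  have [->|s0] := eqVneq s 0; first by rewrite mulr0 sqrt_count0.
  have sq u : u != 0 -> sqrt_count u = 0%N \/ exists2 x, x != 0 & u = x ^+ 2.
    move=> u0.
    have [/existsP[x /eqP xu]|nx] := boolP [exists x : F, x ^+ 2 == u].
      by right; exists x; rewrite // -sqrf_eq0 xu.
    left; apply: sqrt_count_nonsquare => x.
    by move: nx; rewrite negb_exists => /forallP.
  have [->|[x x0 sx]] := sq s s0.
    have [->|[y y0 ->]] := sq (nu * s) (mulf_neq0 nu_neq0 s0);
    by rewrite ?sqrt_count_sqr.
  have [->|[y y0 sy]] := sq (nu * s) (mulf_neq0 nu_neq0 s0).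
    by rewrite sx sqrt_count_sqr.
  by case/eqP: (nuP (y / x)); rewrite expr_div_n -sy -sx mulfK.
have le s : xpredT s ->
    (sqrt_count s + sqrt_count (nu * s)%R <= 2
       ?= iff (sqrt_count s + sqrt_count (nu * s)%R == 2))%N.
  by split.
have [_ eqs] := leqif_sum le.
have : (\sum_s (sqrt_count s + sqrt_count (nu * s)%R) == \sum_(s : F) 2)%N.
  rewrite big_split /= sum_nat_const muln2 -addnn; apply/eqP; congr addn.
    exact: sum_sqrt_count.
  by rewrite -[RHS]sum_sqrt_count [RHS](reindex_inj (mulfI nu_neq0)).
by rewrite eqs => /forallP/(_ t)/eqP.
Qed.

Lemma square_class a : a != 0 ->
  exists2 x, x != 0 & a = x ^+ 2 \/ a = nu * x ^+ 2.
Proof.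
move=> a0.
have sq u : u != 0 -> (0 < sqrt_count u)%N -> exists2 x, x != 0 & u = x ^+ 2.
  move=> u0 /card_gt0P[x]; rewrite inE => /eqP xu; exists x => //.
  by rewrite -sqrf_eq0 xu.
have := sqrt_count_nu (a / nu); rewrite [nu * _]mulrC divfK ?nu_neq0 //.
have [a_gt0|] := ltnP 0 (sqrt_count a).
  by case: (sq _ a0 a_gt0) => x x0 ->; exists x => //; left.
rewrite leqn0 => /eqP->; rewrite addn0 => a2.
have [||x x0 ax] := sq (a / nu); rewrite ?a2 ?mulf_neq0 ?invr_eq0 ?nu_neq0 //.
by exists x => //; right; rewrite -ax mulrC divfK ?nu_neq0.
Qed.
End Nonsquare.

(** Through x^2 + y^2 = (x + i y) (x - i y) = u v: the pairs with u = 0 give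
    q f(0), and for each other u the product u v runs once through the field. *)
Lemma sum_two_squares (i : F) (f : F -> nat) : i ^+ 2 = -1 ->
  (\sum_x \sum_y f (x ^+ 2 + y ^+ 2)%R = q * f 0%R + q.-1 * \sum_t f t)%N.
Proof.
move=> ii; have i0 : i != 0 by rewrite -sqrf_eq0 ii oppr_eq0 oner_eq0.
have four_neq0 : 4%:R != 0 :> F by rewrite (natrM _ 2 2) mulf_neq0.
pose h (z : F * F) : F * F := ((z.1 + z.2) / 2%:R, (z.1 - z.2) / (2%:R * i)).
pose g (z : F * F) : F * F := (z.1 + i * z.2, z.1 - i * z.2).
have hg : cancel g h.
  by case=> x y; rewrite /h /g /=; congr (_, _); field; rewrite ?i0 ?two_neq0.
have gh : cancel h g.
  by case=> x y; rewrite /h /g /=; congr (_, _); field; rewrite ?i0 ?two_neq0.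
rewrite pair_big /= (reindex h) /=; last by exists g => z _.
transitivity (\sum_u \sum_v f (u * v)%R)%N.
  rewrite pair_big /=; apply: eq_bigr => -[u v] _ /=; congr f.
  have -> : ((u - v) / (2%:R * i)) ^+ 2 = (u - v) ^+ 2 / (4%:R * i ^+ 2).
    by field; rewrite i0 four_neq0 two_neq0.
  by rewrite ii; field; rewrite oppr_eq0 four_neq0 two_neq0.
rewrite (bigD1 (0 : F)) //=; congr addn.
  rewrite (eq_bigr (fun=> f 0)) ?sum_nat_const // => v _; by rewrite mul0r.
rewrite (eq_bigr (fun=> \sum_t f t)%N); last first.
  by move=> u u0; rewrite [RHS](reindex_inj (mulfI u0)).
by rewrite sum_nat_const; congr (_ * _)%N; rewrite cardC1.
Qed.

Lemma card_norm_dsum n (H : 'M[F]_n) (a c : F) :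
  #|frames (dsum (a%:M : 'M_1) H) (c%:M : 'M_1)|
    = (\sum_x #|frames H ((c - a * x ^+ 2)%:M : 'M_1)|)%N.
Proof.
rewrite -sum1_card.
rewrite (partition_big (fun v : 'M_(1, 1 + n) => lsubmx v 0 0) xpredT) //=.
apply: eq_bigr => x _; rewrite sum1dep_card.
have inj : injective (fun Y : 'M[F]_(1, n) => row_mx (x%:M : 'M_1) Y).
  by move=> Y Y' /eq_row_mx[].
rewrite -(card_imset _ inj); apply: eq_card => v; rewrite !inE.
have nE (Y : 'M[F]_(1, n)) :
    (row_mx x%:M Y *m dsum (a%:M : 'M_1) H *m (row_mx x%:M Y)^T == c%:M)
    = (Y *m H *m Y^T == (c - a * x ^+ 2)%:M).
  rewrite tr_row_mx mul_row_block !mulmx0 addr0 add0r mul_row_col tr_scalar_mx.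
  rewrite -!scalar_mxM raddfB /= [RHS]eq_sym subr_eq [RHS]eq_sym addrC.
  by congr (_ + _%:M == _); ring.
apply/andP/imsetP => [[vc /eqP vx]|[Y]].
  exists (rsubmx v); last by rewrite -[LHS]hsubmxK -vx -mx11_scalar.
  by rewrite inE -nE -vx -mx11_scalar hsubmxK.
by rewrite inE -nE => Yc ->; split; rewrite // row_mxKl mxE eqxx.
Qed.

Lemma card_norm_scalar (d c : F) : d != 0 ->
  #|frames (d%:M : 'M_1) (c%:M : 'M_1)| = sqrt_count (c / d).
Proof.
move=> d0; have inj := @scalar_mx1_inj F.
rewrite /sqrt_count -[RHS](card_imset _ inj); apply: eq_card => v; rewrite !inE.
have nE x : ((x%:M : 'M_1) *m d%:M *m (x%:M)^T == c%:M) = (x ^+ 2 == c / d).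
  rewrite tr_scalar_mx -!scalar_mxM (inj_eq inj) -[RHS](inj_eq (mulIf d0)).
  by rewrite divfK //; congr (_ == _); ring.
apply/idP/imsetP => [vc|[x]]; last by rewrite inE -nE => xc ->.
by exists (v 0 0); rewrite ?inE -?nE -?mx11_scalar.
Qed.

Lemma sum_card_norm n (H : 'M[F]_n) :
  (\sum_t #|frames H (t%:M : 'M_1)| = q ^ n)%N.
Proof.
rewrite -[n in RHS]mul1n -card_mx -sum1_card.
rewrite (partition_big (fun v : 'M_(1, n) => (v *m H *m v^T) 0 0) xpredT) //=.
apply: eq_bigr => t _; rewrite sum1dep_card; apply: eq_card => v; rewrite !inE.
by rewrite [in LHS](mx11_scalar (v *m H *m _)) (inj_eq (@scalar_mx1_inj _)).
Qed.

Section MinusOneSquare.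
Variable i : F.
Hypothesis iP : i ^+ 2 = -1.

(** The recursion behind all counts of vectors of given norm: two coordinates
    of a sum of squares are eliminated by [sum_two_squares]. *)
Lemma card_norm_hyperbolic n (H : 'M[F]_n) c :
  #|frames (dsum (1%:M : 'M_1) (dsum (1%:M : 'M_1) H)) (c%:M : 'M_1)|
    = (q * #|frames H (c%:M : 'M_1)| + q.-1 * q ^ n)%N.
Proof.
rewrite card_norm_dsum.
transitivity (\sum_x \sum_y #|frames H ((c - (x ^+ 2 + y ^+ 2))%:M : 'M_1)|)%N.
  apply: eq_bigr => x _; rewrite card_norm_dsum; apply: eq_bigr => y _.
  by rewrite !mul1r opprD addrA.
rewrite (sum_two_squares (fun t => #|frames H ((c - t)%:M : 'M_1)|) iP) subr0.
congr (_ + _ * _)%N; rewrite -[RHS](sum_card_norm H).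
by rewrite [RHS](reindex_inj (inv_inj (subKr c))).
Qed.

End MinusOneSquare.
End FiniteField.

(** * Numbers of unit vectors and of frames *)

Definition norm_count (F : finFieldType) n (c : F) : nat :=
  #|frames (1%:M : 'M[F]_n) (c%:M : 'M_1)|.

(** The index is shifted: the form lives in dimension n.+1. *)
Definition unit_count (F : finFieldType) (d : F) n : nat :=
  #|frames (diag_disc d n) (1%:M : 'M_1)|.

Lemma unit_count1 (F : finFieldType) n :
  unit_count (1 : F) n = norm_count n.+1 (1 : F).
Proof. by rewrite /unit_count diag_disc1. Qed.

Section Counting.
Variable F : finFieldType.
Hypothesis two_neq0 : 2%:R != 0 :> F.
Variable i : F.
Hypothesis iP : i ^+ 2 = -1.
Variable nu : F.
Hypothesis nuP : forall x, x ^+ 2 != nu.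
Local Notation q := #|F|.
Local Notation Q := (q%:R : int).

Lemma predq : (q.-1%:R = Q - 1 :> int).
Proof. by rewrite -subn1 natrB //; apply/card_gt0P; exists 0. Qed.

Lemma norm_count0 (c : F) : c != 0 -> norm_count 0 c = 0%N.
Proof.
move=> c0; apply: eq_card0 => X; rewrite !inE thinmx0 !mul0mx.
by apply: contra_neqF c0 => /eqP/matrixP/(_ 0 0); rewrite !mxE => ->.
Qed.

Lemma norm_count1 (c : F) : norm_count 1 c = sqrt_count c.
Proof. by rewrite /norm_count card_norm_scalar ?oner_neq0 // divr1. Qed.

Lemma norm_countSS n (c : F) :
  (norm_count n.+2 c)%:R = Q * (norm_count n c)%:R + (Q - 1) * Q ^+ n.
Proof.
rewrite /norm_count (one_dsum F n.+1) (one_dsum F n).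
rewrite (card_norm_hyperbolic two_neq0 iP).
by rewrite natrD !natrM natrX predq.
Qed.

Lemma unit_countSS (d : F) n :
  (unit_count d n.+2)%:R = Q * (unit_count d n)%:R + (Q - 1) * Q ^+ n.+1.
Proof.
rewrite /unit_count (card_norm_hyperbolic two_neq0 iP (diag_disc d n) 1).
by rewrite natrD !natrM natrX predq.
Qed.

Lemma norm_count_even m (c : F) : c != 0 ->
  (norm_count m.*2.+2 c)%:R = Q ^+ m * (Q ^+ m.+1 - 1).
Proof.
move=> c0; elim: m => [|m IH].
  by rewrite norm_countSS norm_count0 // mulr0 add0r !expr0 mulr1 mul1r.
rewrite doubleS norm_countSS IH -muln2 -[(_ * 2).+2]/(2 + m * 2)%N exprD exprM.
by rewrite !exprS expr0; ring.
Qed.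

Lemma norm_count_odd m (c : F) :
  (norm_count m.*2.+1 c)%:R = Q ^+ m * (Q ^+ m + (sqrt_count c)%:R - 1).
Proof.
elim: m => [|m IH]; first by rewrite norm_count1 !expr0 mul1r addrC addKr.
rewrite doubleS norm_countSS IH -muln2 -[(_ * 2).+1]/(1 + m * 2)%N exprD exprM.
by rewrite !exprS expr0; ring.
Qed.

(** Fixing the first coordinate x, the unit vectors of diag(1, nu) and of
    diag(1, 1) number the square roots of t / nu and of t, for t = 1 - x^2; by
    [sqrt_count_nu] these add up to 2 for every x. *)
Lemma unit_count_nu1 : (unit_count nu 1)%:R = Q + 1.
Proof.
have nu0 := nu_neq0 nuP.
have : (unit_count nu 1 + norm_count 2 (1%R : F) = q * 2)%N.
  rewrite /unit_count /norm_count (one_dsum F 1) diag_discS !card_norm_dsum.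
  rewrite -big_split /=.
  rewrite -sum_nat_const; apply: eq_bigr => x _.
  rewrite !card_norm_scalar ?oner_neq0 // divr1 addnC.
  rewrite -[in RHS](sqrt_count_nu two_neq0 nuP ((1 - 1 * x ^+ 2) / nu)).
  by rewrite [nu * _]mulrC divfK // addnC.
move/(congr1 (fun n => n%:R : int)).
rewrite natrD (@norm_count_even 0) ?oner_neq0 //.
rewrite expr0 expr1 mul1r natrM => /(canRL (addrK _)) ->; ring.
Qed.

Lemma unit_count_nu_odd m :
  (unit_count nu m.*2.+1)%:R = Q ^+ m * (Q ^+ m.+1 + 1).
Proof.
elim: m => [|m IH]; first by rewrite unit_count_nu1 expr0 mul1r expr1.
rewrite doubleS unit_countSS IH -muln2 -[(_ * 2).+2]/(2 + m * 2)%N exprD exprM.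
by rewrite !exprS expr0; ring.
Qed.

Lemma unit_count_nu_even m : (unit_count nu m.*2)%:R = Q ^+ m * (Q ^+ m - 1).
Proof.
elim: m => [|m IH].
  rewrite /unit_count card_norm_scalar ?(nu_neq0 nuP) // sqrt_count_nonsquare.
    by rewrite !expr0 subrr mulr0.
  move=> x; apply: contraNneq (nuP x^-1) => /(congr1 GRing.inv).
  by rewrite -exprVn mul1r invrK => ->.
rewrite doubleS unit_countSS IH -muln2 -[(_ * 2).+1]/(1 + m * 2)%N exprD exprM.
by rewrite !exprS expr0; ring.
Qed.

Lemma card_frames_diag_disc k c (d : F) :
  #|frames (1%:M : 'M[F]_(k + c)) (diag_disc d k)| =
  (\prod_(j < k) norm_count (c.+1 + j) (1%R : F) * norm_count c d)%N.
Proof.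
elim: k => [|k IH]; first by rewrite big_ord0 mul1n.
rewrite -[(k.+1 + c)%N]/(1 + (k + c))%N diag_discS (one_dsum F (k + c)).
rewrite (card_frames_peel two_neq0) ?trmx1 // IH big_ord_recr /=.
have -> : (c.+1 + k = 1 + (k + c))%N by lia.
by rewrite -one_dsum mulnA [(_ * \prod_(_ < _) _)%N]mulnC.
Qed.

Lemma card_frames_self k (d : F) : d != 0 ->
  #|frames (diag_disc d k) (diag_disc d k)| =
  (\prod_(j < k) unit_count d j.+1 * 2)%N.
Proof.
move=> d0; elim: k => [|k IH].
  rewrite big_ord0 mul1n card_norm_scalar // divff //.
  by rewrite -[X in sqrt_count X](expr1n _ 2) sqrt_count_sqr ?oner_neq0.
rewrite diag_discS (card_frames_peel two_neq0) ?diag_disc_sym // IH.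
by rewrite big_ord_recr /= mulnA [(_ * \prod_(_ < _) _)%N]mulnC.
Qed.

End Counting.

(** * Symmetric forms over a finite field *)

Section Diagonalization.
Variable K : fieldType.

(** By polarization, a symmetric form without vectors of nonzero norm
    vanishes. *)
Lemma sym_nonisotropic n (G : 'M[K]_n) : 2%:R != 0 :> K -> G^T = G -> G != 0 ->
  exists v : 'rV_n, exists2 a, a != 0 & v *m G *m v^T = a%:M.
Proof.
move=> two sG /matrix0Pn[i [j Gij]].
have entryE a b : delta_mx 0 a *m G *m (delta_mx 0 b)^T = (G a b)%:M :> 'M_1.
  by rewrite -rowE trmx_delta -colE [LHS]mx11_scalar !mxE.
have [Gi|Gi] := eqVneq (G i i) 0; last by exists (delta_mx 0 i), (G i i).
have [Gj|Gj] := eqVneq (G j j) 0; last by exists (delta_mx 0 j), (G j j).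
exists (delta_mx 0 i + delta_mx 0 j), (2%:R * G i j); first by rewrite mulf_neq0.
rewrite linearD /= mulmxDr !mulmxDl !entryE Gi Gj -!raddfD /=.
have -> : G j i = G i j by rewrite -[in LHS]sG mxE.
by congr _%:M; ring.
Qed.

Lemma row_basis_of_rank m n (A : 'M[K]_(m, n)) r : \rank A = r ->
  exists2 B : 'M_(r, n), row_free B & (B :=: A)%MS.
Proof.
move=> <-; exists (row_base A); [exact: row_base_free | exact: eq_row_base].
Qed.

(** P is v followed by a basis of the orthogonal complement of v. *)
Lemma orthogonal_splitting n (G : 'M[K]_(1 + n)) (v : 'rV_(1 + n)) a :
    G^T = G -> v *m G *m v^T = a%:M -> a != 0 ->
  exists2 P, P \in unitmx & exists2 G' : 'M_n, G'^T = G' &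
    P *m G *m P^T = dsum (a%:M : 'M_1) G'.
Proof.
move=> sG va a0; set c := G *m v^T.
have rc : \rank c = 1%N.
  apply/eqP; rewrite eqn_leq rank_leq_col lt0n mxrank_eq0.
  apply: contraNneq a0 => c0; move: va; rewrite -mulmxA -/c c0 mulmx0.
  by move/matrixP/(_ 0 0); rewrite !mxE eqxx mulr1n => <-.
have [|W Wfree Wker] := @row_basis_of_rank _ _ (kermx c) n.
  by rewrite mxrank_ker rc add1n subn1.
have Wc : W *m c = 0 by apply/sub_kermxP; rewrite Wker.
have cW : v *m G *m W^T = 0.
  by apply: trmx_inj; rewrite !trmx_mul trmxK sG trmx0.
exists (col_mx v W).
  rewrite -row_free_unit; apply: inj_row_free => u.
  rewrite -[u]hsubmxK mul_row_col => uP.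
  have u1 : lsubmx u = 0.
    move/(congr1 (mulmx^~ c)): uP; rewrite mulmxDl -!mulmxA Wc mulmx0 addr0 mul0mx.
    rewrite /c (mulmxA v) va [lsubmx u]mx11_scalar -scalar_mxM.
    move/matrixP/(_ 0 0)/eqP; rewrite !mxE eqxx mulr1n mulf_eq0 (negbTE a0) orbF.
    by move/eqP->; rewrite raddf0.
  rewrite u1 mul0mx add0r in uP *.
  by rewrite (row_free_inj Wfree (etrans uP (esym (mul0mx _ W)))) row_mx0.
exists (W *m G *m W^T); first by rewrite !trmx_mul trmxK sG mulmxA.
rewrite tr_col_mx mul_col_mx mul_col_row va cW -mulmxA -/c Wc.
by [].
Qed.

Lemma dsum_unit n (a : K) (G : 'M_n) :
  (dsum (a%:M : 'M_1) G \in unitmx) = (a != 0) && (G \in unitmx).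
Proof. by rewrite !unitmxE det_ublock det_scalar1 unitrM unitfE. Qed.

Lemma congr_unit n (P G : 'M[K]_n) : P \in unitmx ->
  (P *m G *m P^T \in unitmx) = (G \in unitmx).
Proof. by move=> uP; rewrite !unitmx_mul unitmx_tr uP andbT. Qed.

End Diagonalization.

Section Classification.
Variable F : finFieldType.
Hypothesis two_neq0 : 2%:R != 0 :> F.
Variable i : F.
Hypothesis iP : i ^+ 2 = -1.
Variable nu : F.
Hypothesis nuP : forall x, x ^+ 2 != nu.

(** If one coefficient is a square, a multiple of a basis vector will do.
    Otherwise a = nu s^2 and b = nu t^2, and 1 / nu has to be a sum of two
    squares; it is one because w = ((w + 1)/2)^2 + (i (w - 1)/2)^2. *)
Lemma binary_represents1 (a b : F) : a != 0 -> b != 0 ->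
  exists x, exists y, a * x ^+ 2 + b * y ^+ 2 = 1.
Proof.
have i0 : i != 0 by rewrite -sqrf_eq0 iP oppr_eq0 oner_eq0.
have nu0 := nu_neq0 nuP.
move=> /(square_class two_neq0 nuP)[s s0 [->|->]].
  by move=> _; exists s^-1, 0; field.
move=> /(square_class two_neq0 nuP)[t t0 [->|->]].
  by exists 0, t^-1; field.
exists ((nu^-1 + 1) / 2%:R / s), ((nu^-1 - 1) / 2%:R * i / t).
have -> : ((nu^-1 - 1) / 2%:R * i / t) ^+ 2 = - ((nu^-1 - 1) / 2%:R / t) ^+ 2.
  by rewrite !exprMn iP; ring.
by field; rewrite s0 t0 nu0 two_neq0.
Qed.

Lemma represents1 n (G : 'M[F]_n.+2) : G^T = G -> G \in unitmx ->
  exists v : 'rV_n.+2, v *m G *m v^T = 1%:M.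
Proof.
have unit0 m : (0 : 'M[F]_m.+1) \in unitmx = false.
  by rewrite unitmxE det0 unitr0.
move=> sG uG; have G0 : G != 0 by apply: contraTneq uG => ->; rewrite unit0.
have [v [a a0 va]] := sym_nonisotropic two_neq0 sG G0.
have [P uP [G' sG' PG]] := @orthogonal_splitting F n.+1 G v a sG va a0.
have : G' \in unitmx by rewrite -(congr_unit G uP) PG dsum_unit a0 in uG.
have [->|G'0 _] := eqVneq G' 0; first by rewrite unit0.
have [u [b b0 ub]] := sym_nonisotropic two_neq0 sG' G'0.
have [x [y xy]] := binary_represents1 a0 b0.
exists (row_mx (x%:M : 'M_1) (y *: u) *m P).
rewrite trmx_mul -!mulmxA (mulmxA P) (mulmxA (P *m G)) PG mulmxA.
rewrite tr_row_mx mul_row_block !mulmx0 addr0 add0r mul_row_col tr_scalar_mx.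
rewrite -!scalar_mxM linearZ /= -scalemxAr -!scalemxAl ub scalerA scale_scalar_mx.
by rewrite -raddfD /= -xy; congr _%:M; ring.
Qed.

(** In dimension at least 2 the form represents 1, so that a coefficient 1 can
    be split off; in dimension 1 only the square class of the coefficient
    matters. *)
Lemma classification k (G : 'M[F]_k.+1) : G^T = G -> G \in unitmx ->
  exists2 P, P \in unitmx &
    exists2 d, d \in [:: 1; nu] & P *m G *m P^T = diag_disc d k.
Proof.
elim: k G => [|k IH] G sG uG.
  have [a Ga] : exists a, G = a%:M by exists (G 0 0); exact: mx11_scalar.
  have a0 : a != 0 by move: uG; rewrite unitmxE Ga det_scalar1 unitfE.
  have [x x0 ax] := square_class two_neq0 nuP a0.
  exists (x^-1)%:M; first by rewrite unitmxE det_scalar1 unitfE invr_eq0.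
  rewrite Ga tr_scalar_mx -!scalar_mxM.
  case: ax => ->; [exists 1|exists nu]; rewrite ?inE ?eqxx ?orbT //=.
    by congr _%:M; field.
  by congr _%:M; field.
have [v v1] := represents1 sG uG.
have [P uP [G' sG' PG]] := @orthogonal_splitting F k.+1 G v 1 sG v1 (oner_neq0 _).
have uG' : G' \in unitmx.
  by move: uG; rewrite -(congr_unit G uP) PG dsum_unit => /andP[].
have [P' uP' [d d_in dP]] := IH G' sG' uG'.
exists (dsum (1%:M : 'M_1) P' *m P).
  by rewrite unitmx_mul dsum_unit oner_neq0 uP' uP.
exists d => //; rewrite trmx_mul -!mulmxA (mulmxA P) (mulmxA (P *m G)) PG mulmxA.
by rewrite diag_discS -dP; exact: congr_dsum.
Qed.

End Classification.

(** * Points of the Grassmannian as nondegenerate subspaces *)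

Lemma map_diag_disc (R S : pzRingType) (f : {rmorphism R -> S}) d k :
  map_mx f (diag_disc d k) = diag_disc (f d) k.
Proof.
elim: k => [|k IH]; first by rewrite map_scalar_mx.
rewrite -[k.+2]/(1 + k.+1)%N !diag_discS.
by rewrite map_block_mx !map_mx0 map_mx1 IH.
Qed.

Section Orbit.
Variable K : fieldType.

Lemma eqmx_pid k n : ((pid_mx k : 'M[K]_(k, n)) :=: (pid_mx k : 'M[K]_n))%MS.
Proof.
apply/eqmxP/andP; split.
  have -> : pid_mx k = pid_mx k *m (pid_mx k : 'M_n) :> 'M[K]_(k, n).
    by rewrite mul_pid_mx minnn pid_mx_minh.
  exact: submxMl.
have -> : pid_mx k = (pid_mx k : 'M_(n, k)) *m pid_mx k :> 'M[K]_n.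
  by rewrite mul_pid_mx !minnn.
exact: submxMl.
Qed.

Hypothesis two_neq0 : 2%:R != 0 :> K.

(** If the orthonormal basis extending Z has determinant -1, changing the sign
    of its first vector repairs this and keeps the span of Z. *)
Lemma orthonormal_in_orbit k n (Z : 'M[K]_(k.+1, n.+1)) :
  Z *m Z^T = 1%:M -> in_SO_orbit k.+1 Z.
Proof.
move=> /(orthonormal_extend two_neq0)[g gg ->].
have pg : ((pid_mx k.+1 : 'M_(k.+1, n.+1)) *m g
             :=: (pid_mx k.+1 : 'M_n.+1) *m g)%MS.
  by apply: eqmxMr; exact: eqmx_pid.
have : (\det g) ^+ 2 == 1 by rewrite expr2 -{2}(det_tr g) -det_mulmx gg det1.
rewrite sqrf_eq1 => /orP[] /eqP dg; first by exists g => //; apply/eqmxP.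
pose D : 'M[K]_(1 + n) := dsum ((-1)%:M : 'M_1) 1%:M.
have DD : D *m D = 1%:M.
  rewrite mulmx_block !mulmx0 !mul0mx -!scalar_mxM mulrNN mulr1.
  by rewrite !addr0 !add0r -one_dsum.
have DT : D^T = D by rewrite dsum_sym ?tr_scalar_mx.
have dD : \det D = -1 by rewrite det_ublock det_scalar1 det1 mulr1.
have pD : pid_mx k.+1 *m D = D *m pid_mx k.+1 :> 'M_(1 + n).
  by rewrite !pid_mxS !mulmx_block !(mulmx0, mul0mx, mulmx1, mul1mx, addr0, add0r).
exists (D *m g).
  split; last by rewrite det_mulmx dD dg mulrNN mulr1.
  by rewrite trmx_mul DT -mulmxA (mulmxA g) gg mul1mx.
apply/eqmxP; apply: eqmx_trans pg _.
rewrite mulmxA [X in (_ :=: X *m _)%MS]pD -mulmxA; apply/eqmx_sym/eqmxMfull.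
by rewrite row_full_unit; exact: (proj1 (mulmx1_unit DD)).
Qed.

(** A basis of a subspace in the orbit is an invertible matrix P times
    orthonormal rows, so its Gram matrix is P P^T. *)
Lemma orbit_basis k n (A : 'M[K]_n) : (k <= n)%N -> in_SO_orbit k A ->
  \rank A = k /\ forall B : 'M_(k, n), (B :=: A)%MS -> B *m B^T \in unitmx.
Proof.
move=> kn [g [gg _] /eqmxP Ag].
have ug : g \in unitmx by case/mulmx1_unit: gg.
have rA : \rank A = k.
  by rewrite Ag mxrankMfree ?row_free_unit // rank_pid_mx.
split=> // B BA.
have : (B <= (pid_mx k : 'M_(k, n)) *m g)%MS.
  rewrite BA Ag; apply: submxMr; by rewrite eqmx_pid.
case/submxP=> P BP.
have uP : P \in unitmx.
  rewrite -row_free_unit -row_leq_rank -{1}rA -BA BP; exact: mxrankM_maxl.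
rewrite BP !trmx_mul -!mulmxA (mulmxA g) gg mul1mx (mulmxA (pid_mx k)) tr_pid_mx.
by rewrite mul_pid_mx minnn (minn_idPr kn) pid_mx_1 mul1mx unitmx_mul unitmx_tr uP.
Qed.
End Orbit.

Section Points.
Variable F : finFieldType.
Hypothesis two_neq0 : 2%:R != 0 :> F.
Variable i : F.
Hypothesis iP : i ^+ 2 = -1.
Variable nu : F.
Hypothesis nuP : forall x, x ^+ 2 != nu.

(** The nondegenerate subspaces of dimension k.+1 and discriminant d, up to
    squares, each given by its canonical matrix. *)
Definition framed n k (d : F) : {set 'M[F]_n} :=
  [set <<X>>%MS | X in frames (1%:M : 'M_n) (diag_disc d k)].

(** From left to right the Gram matrix of a basis is brought to normal form
    over F; from right to left the remaining coefficient d becomes a square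
    over K, and dividing the last row by its root makes the rows
    orthonormal. *)
Lemma Gr_points_framed (K : closedFieldType) (iota : {rmorphism F -> K}) k n :
  (k < n)%N -> Gr_points iota k.+1 n = framed n k 1 :|: framed n k nu.
Proof.
move=> kn; apply/setP=> A.
have twoK : 2%:R != 0 :> K by rewrite -(rmorph_nat iota) fmorph_eq0.
have -> : (A \in framed n k 1 :|: framed n k nu) =
    [exists d in [:: 1; nu], A \in framed n k d].
  rewrite inE; apply/orP/exists_inP => [[]|[d]].
  - by exists 1; rewrite ?inE ?eqxx.
  - by exists nu; rewrite ?inE ?eqxx ?orbT.
  by rewrite !inE => /orP[] /eqP ->; [left|right].
rewrite inE; apply/andP/exists_inP => [[/eqP A_gen /asboolP A_orb]|[d d_in]].
  have [rA unitB] := orbit_basis kn A_orb; rewrite mxrank_map in rA.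
  have [B Bfree BA] := row_basis_of_rank rA.
  have uG : B *m B^T \in unitmx.
    rewrite -(map_unitmx iota) map_mxM -map_trmx; apply: unitB.
    by apply/map_eqmx.
  have sG : (B *m B^T)^T = B *m B^T by rewrite trmx_mul trmxK.
  have [P uP [d d_in dP]] := classification two_neq0 iP nuP sG uG.
  exists d => //; apply/imsetP; exists (P *m B).
    by rewrite inE mulmx1 trmx_mul !mulmxA -(mulmxA P) dP.
  rewrite -A_gen; apply/esym/eq_genmx/eqmx_trans; last exact: BA.
  by apply: eqmxMfull; rewrite row_full_unit.
case/imsetP => X; rewrite inE mulmx1 => /eqP Xd ->{A}.
split; first by rewrite genmx_id.
apply/asboolP; case: n kn X Xd => [|n] // kn X Xd.
have [r rP] : exists r : K, r ^+ 2 = iota d.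
  have /closed_rootP[r] : size ('X^2 - (iota d)%:P) != 1%N by rewrite size_XnsubC.
  by rewrite rootE !hornerE subr_eq0 => /eqP; exists r.
have d0 : d != 0.
  by move: d_in; rewrite !inE => /orP[] /eqP->; rewrite ?oner_neq0 ?(nu_neq0 nuP).
have r0 : r != 0 by rewrite -sqrf_eq0 rP fmorph_eq0.
pose Z := diag_disc r^-1 k *m map_mx iota X.
have ZZ : Z *m Z^T = 1%:M.
  rewrite trmx_mul diag_disc_sym !mulmxA -(mulmxA (diag_disc _ _)).
  rewrite map_trmx -map_mxM Xd map_diag_disc.
  by rewrite !diag_discM -rP -diag_disc1; congr (diag_disc _ k); field.
have [g SOg /eqmxP Zg] := orthonormal_in_orbit twoK ZZ.
exists g => //; apply/eqmxP/(eqmx_trans _ Zg).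
apply: eqmx_trans (eqmx_sym (eqmxMfull _ _)).
  by apply: eqmx_trans (map_genmx _ _) (genmxE _).
by rewrite row_full_unit unitmxE det_diag_disc unitfE invr_eq0.
Qed.

(** Two Gram matrices of the same subspace have determinants that differ by a
    square factor. *)
Lemma framed_disjoint n k : [disjoint framed n k 1 & framed n k nu].
Proof.
rewrite -setI_eq0; apply/eqP/setP=> A; rewrite !inE; apply/andP => -[].
case/imsetP => X; rewrite inE mulmx1 => /eqP X1 -> /imsetP[Y].
rewrite inE mulmx1 => /eqP Ynu /genmxP/eqmxP XY.
have /submxP[P XP] : (X <= Y)%MS by rewrite XY.
move: X1; rewrite XP trmx_mul mulmxA -(mulmxA P) Ynu => /(congr1 determinant).
rewrite !det_mulmx det_tr !det_diag_disc => detP.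
have P0 : \det P != 0.
  by apply: contra_eq_neq detP => ->; rewrite !mul0r eq_sym oner_neq0.
by case/eqP: (nuP (\det P)^-1); rewrite -[LHS]mul1r -detP; field.
Qed.

(** The bases of a subspace with Gram matrix D form one regular orbit of the
    group of isometries of D. *)
Lemma card_framed n k d : d != 0 ->
  (#|framed n k d| * #|frames (diag_disc d k) (diag_disc d k)| =
   #|frames (1%:M : 'M[F]_n) (diag_disc d k)|)%N.
Proof.
move=> d0; rewrite -[RHS]sum1_card.
rewrite [RHS](partition_big (fun X => <<X>>%MS) (mem (framed n k d))) /=; last first.
  by move=> X Xd; rewrite imset_f.
rewrite -sum_nat_const; apply: eq_bigr => A /imsetP[X Xd ->].
have Xd' : X *m X^T = diag_disc d k by move: Xd; rewrite inE mulmx1 => /eqP.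
have unitD : diag_disc d k \in unitmx by rewrite unitmxE det_diag_disc unitfE.
have Xfree : row_free X.
  by rewrite -row_leq_rank -{1}(mxrank_unit unitD) -Xd'; exact: mxrankM_maxl.
rewrite sum1dep_card -(card_imset _ (row_free_inj Xfree)).
apply: eq_card => Y; rewrite !inE; apply/imsetP/andP => [[P]|].
  rewrite inE => /eqP PP ->; rewrite mulmx1 trmx_mul mulmxA -(mulmxA P) Xd' PP eqxx.
  split=> //; apply/eqP/eq_genmx/eqmxMfull; rewrite row_full_unit.
  by move: unitD; rewrite -PP !unitmx_mul => /andP[/andP[]].
rewrite mulmx1 => -[/eqP YY /eqP/genmxP/eqmxP YX].
have /submxP[P YP] : (Y <= X)%MS by rewrite YX.
by exists P; rewrite // inE -Xd' mulmxA -mulmxA -trmx_mul -YP YY Xd'.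
Qed.

End Points.

(** * Elementary symmetric polynomials of the weights *)

Section SchubertSets.
Variables k n : nat.
Implicit Type s : schubert k n.

Definition schubert_set s : {set 'I_n} := [set entry s i | i : 'I_k].

Lemma entry_inj s : injective (entry s).
Proof.
move=> i j /(congr1 val) /= sij; apply: val_inj => /=.
by case: (ltngtP i j) => // /(entry_lt s); rewrite sij ltnn.
Qed.

Lemma schubert_set_inj : injective schubert_set.
Proof.
pose es s := [seq val (entry s i) | i <- enum 'I_k].
have es_sorted s : sorted ltn (es s).
  rewrite sorted_map.
  apply: (@sub_sorted _ (relpre val ltn)) => [i j /=|]; first exact: entry_lt.
  by rewrite -(sorted_map (f := val)) val_enum_ord iota_ltn_sorted.
move=> s t st; have /eq_in_map est : es s = es t.
  apply: (irr_sorted_eq ltn_trans ltnn) => // x.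
  have mem_es u : (x \in es u) = [exists a in schubert_set u, val a == x].
    apply/mapP/exists_inP => [[i _ ->]|[a /imsetP[i _ ->] /eqP <-]].
      by exists (entry u i); rewrite ?imset_f.
    by exists i; rewrite ?mem_enum.
  by rewrite !mem_es st.
by apply/val_inj/ffunP => i; apply/val_inj/est; rewrite mem_enum.
Qed.

Lemma schubert_set_imset :
  schubert_set @: setT = [set J : {set 'I_n} | #|J| == k].
Proof.
apply/setP=> J; rewrite inE; apply/imsetP/eqP => [[s _ ->]|Jk].
  by rewrite card_imset ?card_ord //; exact: entry_inj.
pose f := [ffun i : 'I_k => enum_val (cast_ord (esym Jk) i)].
have f_incr : [forall i : 'I_k, forall j : 'I_k, (i < j)%N ==> (f i < f j)%N].
  apply/forallP=> i; apply/forallP=> j; apply/implyP=> ij; rewrite !ffunE.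
  have J_sorted : sorted (relpre val ltn) (enum J).
    apply: sorted_filter => [a b c|]; first exact: ltn_trans.
    by rewrite -enumT -(sorted_map (f := val)) val_enum_ord iota_ltn_sorted.
  rewrite !(enum_val_nth (f i)).
  have trans : transitive (relpre (val : 'I_n -> nat) ltn).
    by move=> a b c; exact: ltn_trans.
  by apply: (sorted_ltn_nth trans (f i) J_sorted); rewrite // inE -cardE ltn_ord.
exists (exist _ f f_incr) => //; apply/setP=> a; apply/idP/imsetP => [aJ|[j _ ->]].
  exists (cast_ord Jk (enum_rank_in aJ a)) => //.
  by rewrite /entry ffunE cast_ordK enum_rankK_in.
by rewrite /entry ffunE enum_valP.
Qed.
End SchubertSets.

(** The k-th elementary symmetric polynomial, encoded as a coefficient so that
    recursions come from splitting off a linear factor. *)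
Definition elsym (R : comNzRingType) (w : nat -> R) n k : R :=
  (\prod_(a < n) (1 + w a *: 'X))`_k.

(** A Schubert symbol is the increasing enumeration of a k-element set. *)
Lemma schubert_sum (R : comNzRingType) (w : nat -> R) n k :
  \sum_(s : schubert k n) \prod_(i < k) w (entry s i) = elsym w n k.
Proof.
rewrite /elsym (eq_bigr (fun a : 'I_n => w a *: 'X + 1)); last first.
  by move=> a _; rewrite addrC.
rewrite bigA_distr coef_sum.
transitivity (\sum_(J : {set 'I_n} | #|J| == k) \prod_(a in J) w a).
  transitivity (\sum_(J in @schubert_set k n @: setT) \prod_(a in J) w a);
    last first.
    by apply: eq_bigl => J; rewrite schubert_set_imset inE.
  rewrite big_imset /=; last by move=> s t _ _; exact: schubert_set_inj.
  apply: eq_big => [s|s _]; first by rewrite inE.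
  by rewrite big_imset //= => i j _ _; exact: entry_inj.
rewrite big_mkcond; apply: eq_bigr => J _.
rewrite -big_mkcond scaler_prod prodr_const coefZ coefXn.
case: (k =P _) => [->|/eqP]; rewrite ?eqxx ?mulr1 //.
by rewrite eq_sym => /negbTE->; rewrite mulr0.
Qed.

Section ElSym.
Variable R : comNzRingType.
Implicit Type w : nat -> R.

Lemma elsymn0 w n : elsym w n 0 = 1.
Proof.
rewrite /elsym -horner_coef0 horner_prod big1 // => a _.
by rewrite !hornerE ?mulr0 ?addr0.
Qed.

Lemma elsym0S w k : elsym w 0 k.+1 = 0.
Proof. by rewrite /elsym big_ord0 coef1. Qed.

Lemma elsymSS w n k : elsym w n.+1 k.+1 = elsym w n k.+1 + w n * elsym w n k.
Proof.
by rewrite /elsym big_ord_recr /= mulrDr mulr1 coefD -scalerAr coefZ coefMX.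
Qed.

Lemma elsym_head w n k :
  elsym w n.+1 k.+1 =
  elsym (fun a => w a.+1) n k.+1 + w 0%N * elsym (fun a => w a.+1) n k.
Proof.
by rewrite /elsym big_ord_recl mulrDl mul1r coefD -scalerAl coefZ coefXM.
Qed.

Lemma elsym_scale (c : R) w n k :
  elsym (fun a => c * w a) n k = c ^+ k * elsym w n k.
Proof.
elim: n k => [|n IH] [|k]; rewrite ?elsymn0 ?elsym0S ?mulr0 ?expr0 ?mulr1 //.
by rewrite !elsymSS !IH exprS; ring.
Qed.

Lemma eq_elsym w w' n k : w =1 w' -> elsym w n k = elsym w' n k.
Proof. by move=> ww'; rewrite /elsym; under eq_bigr do rewrite ww'. Qed.

(** The quotient of [qprod x r s] by [qprod x r 0] is the Gaussian binomial
    coefficient of s + r over r, with base x^2. *)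
Definition qprod (x : R) r s : R := \prod_(j < r) (x ^+ (s + j).+1.*2 - 1).

Lemma qprodS x r s : qprod x r.+1 s = qprod x r s * (x ^+ (s + r).+1.*2 - 1).
Proof. exact: big_ord_recr. Qed.

(** The sequence 1, -1, x, -x, x^2, -x^2, ... *)
Definition pair_wt (x : R) a : R := (-1) ^+ a * x ^+ a./2.

Lemma pair_wt_even x m : pair_wt x m.*2 = x ^+ m.
Proof. by rewrite /pair_wt doubleK -mul2n exprM sqrrN !expr1n mul1r. Qed.

Lemma pair_wt_odd x m : pair_wt x m.*2.+1 = - x ^+ m.
Proof.
rewrite /pair_wt /= uphalf_double exprS -mul2n exprM sqrrN !expr1n.
by rewrite mulr1 mulN1r.
Qed.

(** The linear factors of the weights x^j and -x^j multiply to
    1 - x^(2j) Y^2, in a variable Y: odd coefficients vanish, and the even ones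
    are given by the q-binomial theorem with base x^2. *)
Lemma elsym_pair_wt x m r :
  elsym (pair_wt x) m.*2 r.*2.+1 = 0 /\
  elsym (pair_wt x) m.*2 r.*2 * qprod x r 0 =
  (-1) ^+ r * \prod_(j < r) (x ^+ m.*2 - x ^+ j.*2).
Proof.
elim: m r => [|m IH] r.
  case: r => [|r]; first by rewrite elsym0S elsymn0 /qprod !big_ord0 !mulr1.
  by rewrite doubleS !elsym0S big_ord_recl subrr !(mul0r, mulr0).
have step k : elsym (pair_wt x) m.*2.+2 k.+2 =
    elsym (pair_wt x) m.*2 k.+2 - x ^+ m.*2 * elsym (pair_wt x) m.*2 k.
  by rewrite !elsymSS pair_wt_even pair_wt_odd -addnn exprD; ring.
have [IHodd IHeven] := (fun r => proj1 (IH r), fun r => proj2 (IH r)).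
rewrite doubleS; case: r => [|r].
  rewrite elsymn0 /qprod !big_ord0 !mulr1; split=> //.
  by rewrite !elsymSS !elsymn0 IHodd pair_wt_even pair_wt_odd; ring.
rewrite doubleS !step; split; first by rewrite (IHodd r.+1) (IHodd r) mulr0 subrr.
have e1 := IHeven r.+1; have e2 := IHeven r.
rewrite mulrBl e1 qprodS add0n -(mulrA (x ^+ _)) (mulrA (elsym _ _ _)) e2.
rewrite [in RHS]big_ord_recl [in LHS]big_ord_recr /=.
have -> : \prod_(j < r) (x ^+ m.*2.+2 - x ^+ (bump 0 j).*2) =
    x ^+ r.*2 * \prod_(j < r) (x ^+ m.*2 - x ^+ j.*2).
  transitivity (\prod_(j < r) (x ^+ 2 * (x ^+ m.*2 - x ^+ j.*2))).
    by apply: eq_bigr => j _; rewrite mulrBr -!exprD !add2n.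
  by rewrite big_split /= prodr_const card_ord -exprM mul2n.
rewrite expr0 -[m.*2.+2]/(2 + m.*2)%N -[r.+1.*2]/(2 + r.*2)%N !exprD exprS.
move: (\prod_(j < r) (x ^+ m.*2 - x ^+ j.*2)) => P.
move: (x ^+ m.*2) (x ^+ r.*2) (x ^+ 2) ((-1) ^+ r) => y z t u.
by ring.
Qed.
End ElSym.

(** * The polynomial p *)

(** Raising an entry from a to a.+1 multiplies its weight by -1 or by -X,
    according to whether the sign epsilon of the entry is kept or changed. *)
Definition schubert_wt k a : {poly int} :=
  if odd k then (-1) ^+ a * 'X^(uphalf a) else pair_wt 'X a.

Lemma schubert_wtS k a :
  schubert_wt k a.+1 =
  - (if epsi k a.+1 == epsi k a.+2 then 1 else 'X) * schubert_wt k a.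
Proof.
have sign_eq (m m' : nat) : ((-1) ^+ m == (-1) ^+ m' :> int) = (odd m == odd m').
  rewrite -[X in X == _]signr_odd -[X in _ == X]signr_odd.
  by case: (odd m); case: (odd m').
rewrite /schubert_wt /epsi /pair_wt -(odd_double_half a).
have neqN b : (b == ~~ b) = false by case: b.
case: (odd k); case: (odd a); rewrite ?add1n ?add0n sign_eq /=;
  rewrite ?uphalf_double ?doubleK /= ?uphalf_double ?doubleK ?eqxx ?neqN !exprS;
  ring.
Qed.

(** Along a step, only one entry changes, and eps changes exactly when the
    epsilon of this entry does. *)
Lemma weight_eq k n (s : schubert k n) :
  (-1) ^+ len s * 'X^(eta s) * \prod_(i < k) schubert_wt k i =
  \prod_(i < k) schubert_wt k (entry s i).
Proof.
have [d] := ubnP (len s); elim: d s => [//|d IH] s Hd.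
have [eta_e eta_d eta_s] := @etaP k n.
have [es|/step_exists[t st]] := pselect (is_e s).
  rewrite eta_e // /len big1 => [|i _]; last by rewrite es subnn.
  by rewrite !expr0 !mul1r; apply: eq_bigr => i _; rewrite es.
have /IH IHt : (len t < d)%N by rewrite (len_step st) in Hd.
have lenE := len_step st; have [i [si sj]] := st.
have epsE' : (eps t == eps s) = (epsi k (entry t i).+1 == epsi k (entry t i).+2).
  rewrite /eps (bigD1 i) //= [X in _ == X](bigD1 i) //= si.
  rewrite [X in _ == _ * X](eq_bigr (fun j => epsi k (entry t j).+1));
    last by move=> j /sj ->.
  set y := \prod_(j | j != i) _; have y0 : y != 0.
    apply/prodf_neq0 => j _.
    by case/orP: (epsiE k (entry t j).+1) => /eqP->.
  by rewrite (inj_eq (mulIf y0)).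
rewrite [RHS](bigD1 i) //= in IHt.
rewrite [RHS](bigD1 i) //= si schubert_wtS -epsE'.
rewrite [X in _ = _ * X](eq_bigr (fun j => schubert_wt k (entry t j)));
  last by move=> j /sj ->.
rewrite -[RHS]mulrA -IHt lenE exprS !mulN1r !mulNr.
have [e|ne] := eqVneq (eps t) (eps s); first by rewrite (eta_d t s) // mul1r.
rewrite (eta_s t s); last first.
  split=> //; move: ne.
  by case/orP: (epsE t) => /eqP->; case/orP: (epsE s) => /eqP->; rewrite ?eqxx.
by rewrite exprS !mulrA [_ * 'X]mulrC.
Qed.

Lemma p_poly_elsym k n :
  p_poly k n * \prod_(i < k) schubert_wt k i = elsym (schubert_wt k) n k.
Proof.
rewrite -schubert_sum mulr_suml; apply: eq_bigr => s _.
by rewrite -weight_eq -mul_polyC rmorph_sign.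
Qed.

Section Closed.
Variable R : idomainType.
Variable x : R.
Hypothesis x0 : x != 0.

Lemma prod_pair_wt r :
  \prod_(i < r.*2) pair_wt x i = (-1) ^+ r * \prod_(j < r) x ^+ j.*2.
Proof.
elim: r => [|r IH]; first by rewrite !big_ord0 mulr1.
rewrite doubleS !big_ord_recr /= IH pair_wt_even pair_wt_odd exprS -addnn exprD.
by set P := \prod_(_ < _) _; ring.
Qed.

Lemma prod_double_diff r s :
  \prod_(j < r) (x ^+ (s + r).*2 - x ^+ j.*2) =
  \prod_(j < r) x ^+ j.*2 * qprod x r s.
Proof.
rewrite /qprod [X in _ = _ * X](reindex_inj rev_ord_inj) /= -big_split /=.
apply: eq_bigr => j _.
rewrite mulrBr mulr1 -exprD; congr (x ^+ _ - _).
by have := ltn_ord j; lia.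
Qed.

Lemma prod_expr_neq0 r : \prod_(j < r) x ^+ j.*2 != 0.
Proof. by apply/prodf_neq0 => j _; rewrite expf_neq0. Qed.

Lemma prod_pair_wt_neq0 r : \prod_(i < r.*2) pair_wt x i != 0.
Proof. by rewrite prod_pair_wt mulf_neq0 ?signr_eq0 ?prod_expr_neq0. Qed.

Lemma elsym_pair_wt_qprod r s :
  elsym (pair_wt x) (s + r).*2 r.*2 * qprod x r 0 =
  \prod_(i < r.*2) pair_wt x i * qprod x r s.
Proof.
have [_ ->] := elsym_pair_wt x (s + r) r.
by rewrite prod_double_diff prod_pair_wt mulrA.
Qed.

Lemma elsym_pair_wt_odd_even m r :
  elsym (pair_wt x) m.*2.+1 r.*2 = elsym (pair_wt x) m.*2 r.*2.
Proof.
case: r => [|r]; first by rewrite !elsymn0.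
by rewrite doubleS elsymSS (elsym_pair_wt x m r).1 mulr0 addr0.
Qed.

Lemma elsym_pair_wt_odd_odd m r :
  elsym (pair_wt x) m.*2.+1 r.*2.+1 = x ^+ m * elsym (pair_wt x) m.*2 r.*2.
Proof. by rewrite elsymSS (elsym_pair_wt x m r).1 pair_wt_even add0r. Qed.
End Closed.

Local Notation Q r s := (qprod ('X : {poly int}) r s).

Lemma p_poly_even r s (b : bool) :
  p_poly r.*2 (b + (s + r).*2) * Q r 0 = Q r s.
Proof.
have pair_wtE : schubert_wt r.*2 =1 pair_wt 'X.
  by move=> a; rewrite /schubert_wt odd_double.
have X0 : 'X != 0 :> {poly int} by rewrite polyX_eq0.
apply: (mulfI (prod_pair_wt_neq0 X0 r)).
have prodE : \prod_(i < r.*2) pair_wt 'X i = \prod_(i < r.*2) schubert_wt r.*2 i.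
  by apply: eq_bigr => i _; rewrite pair_wtE.
rewrite -elsym_pair_wt_qprod // mulrA [_ * p_poly _ _]mulrC prodE p_poly_elsym.
rewrite (eq_elsym _ _ pair_wtE).
by case: b; rewrite ?add0n ?add1n ?elsym_pair_wt_odd_even.
Qed.

Lemma schubert_wt_odd r a : schubert_wt r.*2.+1 a.+1 = - 'X * pair_wt 'X a.
Proof.
by rewrite /schubert_wt /pair_wt /= odd_double /= !exprS; ring.
Qed.

(** For odd k the weights are 1 followed by -X times the weights of the even
    case. *)
Lemma elsym_schubert_odd r n :
  elsym (schubert_wt r.*2.+1) n.+1 r.*2.+1 =
  'X ^+ r.*2 * (elsym (pair_wt 'X) n r.*2 - 'X * elsym (pair_wt 'X) n r.*2.+1).
Proof.
rewrite elsym_head !(eq_elsym _ _ (schubert_wt_odd r)) !elsym_scale.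
rewrite /schubert_wt /= odd_double /= !expr0 exprS -mul2n exprM sqrrN -exprM; ring.
Qed.

Lemma prod_schubert_odd r :
  \prod_(i < r.*2.+1) schubert_wt r.*2.+1 i =
  'X ^+ r.*2 * \prod_(i < r.*2) pair_wt 'X i.
Proof.
rewrite big_ord_recl /= {1}/schubert_wt /= odd_double /= !expr0 !mul1r.
rewrite (eq_bigr (fun i : 'I_r.*2 => - 'X * pair_wt 'X i)) => [|i _];
  last exact: schubert_wt_odd.
by rewrite big_split /= prodr_const card_ord -mul2n exprM sqrrN -exprM.
Qed.

Lemma p_poly_odd r n T : 
    (elsym (pair_wt 'X) n r.*2 - 'X * elsym (pair_wt 'X) n r.*2.+1) * Q r 0 =
      \prod_(i < r.*2) pair_wt 'X i * T ->
  p_poly r.*2.+1 n.+1 * Q r 0 = T.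
Proof.
have X0 : 'X != 0 :> {poly int} by rewrite polyX_eq0.
move=> eqT; apply: (mulfI (mulf_neq0 (expf_neq0 r.*2 X0) (prod_pair_wt_neq0 X0 r))).
rewrite mulrA [_ * p_poly _ _]mulrC -prod_schubert_odd p_poly_elsym.
rewrite elsym_schubert_odd.
by rewrite -mulrA eqT prod_schubert_odd mulrA.
Qed.

Lemma p_poly_odd_odd r s : p_poly r.*2.+1 (s + r).*2.+1 * Q r 0 = Q r s.
Proof.
apply: p_poly_odd; rewrite (elsym_pair_wt _ _ _).1 mulr0 subr0.
by rewrite elsym_pair_wt_qprod ?polyX_eq0.
Qed.

Lemma p_poly_odd_even r s :
  p_poly r.*2.+1 (s + r).*2.+2 * Q r 0 = (1 - 'X^((s + r).+1)) * Q r s.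
Proof.
apply: p_poly_odd; rewrite elsym_pair_wt_odd_even elsym_pair_wt_odd_odd mulrA -exprS.
rewrite -{1}[elsym _ _ _]mul1r -mulrBl -mulrA.
by rewrite elsym_pair_wt_qprod ?polyX_eq0 // mulrCA.
Qed.

(** * The count in closed form *)

Section Products.
Variable F : finFieldType.
Hypothesis two_neq0 : 2%:R != 0 :> F.
Variable i : F.
Hypothesis iP : i ^+ 2 = -1.
Variable nu : F.
Hypothesis nuP : forall x, x ^+ 2 != nu.
Local Notation q := #|F|.
Local Notation Q := (q%:R : int).
Local Notation S n c := ((norm_count n (c : F))%:R : int).
Local Notation Nf k c d := (#|framed (k + c) k (d : F)|%:R : int).
Local Notation T d n := ((unit_count (d : F) n)%:R : int).

(** The numbers of unit vectors in dimensions 2i and 2i+1 multiply to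
    q^(2i-1) (q^(2i) - 1); here i runs over s < i <= s + r. *)
Definition pairprod r s : int :=
  \prod_(j < r) (Q ^+ (s + j).*2.+1 * (Q ^+ (s + j).+1.*2 - 1)).

Lemma pairprodS r s :
  pairprod r.+1 s =
  pairprod r s * (Q ^+ (s + r).*2.+1 * (Q ^+ (s + r).+1.*2 - 1)).
Proof. exact: big_ord_recr. Qed.

Lemma pairprodE r s : pairprod r s = Q ^+ (r * r + 2 * r * s) * qprod Q r s.
Proof.
elim: r => [|r IH]; first by rewrite /pairprod /qprod !big_ord0 mulr1.
rewrite pairprodS qprodS IH mulrACA -exprD; congr (_ ^+ _ * _); lia.
Qed.

Lemma Q_neq0 : Q != 0.
Proof. by rewrite pnatr_eq0 -lt0n; apply/card_gt0P; exists 0. Qed.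

Lemma norm_count_odd1 s : S s.*2.+1 1 = Q ^+ s * (Q ^+ s + 1).
Proof.
rewrite (norm_count_odd two_neq0 iP) -[X in sqrt_count X](expr1n _ 2).
by rewrite sqrt_count_sqr ?oner_neq0 //; ring.
Qed.

Lemma prod_norm_count r s : \prod_(j < r.*2) S (s.*2.+2 + j) 1 = pairprod r s.
Proof.
elim: r => [|r IH]; first by rewrite /pairprod !big_ord0.
rewrite doubleS !big_ord_recr /= IH pairprodS -mulrA; congr (_ * _).
have -> : (s.*2.+2 + r.*2 = (s + r).*2.+2)%N by lia.
have -> : (s.*2.+2 + r.*2.+1 = (s + r).+1.*2.+1)%N by lia.
rewrite (norm_count_even two_neq0 iP) ?oner_neq0 // norm_count_odd1.
by move: (s + r)%N => m; rewrite doubleS -addnn !exprS !exprD; ring.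
Qed.

Lemma prod_unit_count1 n : \prod_(j < n) T 1 j.+1 = \prod_(j < n) S (2 + j) 1.
Proof. by apply: eq_bigr => j _; rewrite unit_count1. Qed.

(** Here consecutive dimensions pair up to the same products as for a sum of
    squares, although the single factors differ. *)
Lemma prod_unit_count_nu r : \prod_(j < r.*2) T nu j.+1 = pairprod r 0.
Proof.
elim: r => [|r IH]; first by rewrite /pairprod !big_ord0.
rewrite doubleS !big_ord_recr /= IH pairprodS -mulrA; congr (_ * _).
rewrite (unit_count_nu_odd two_neq0 iP nuP) -doubleS.
rewrite (unit_count_nu_even two_neq0 iP nuP).
by rewrite add0n doubleS -addnn !exprS !exprD; ring.
Qed.

Lemma card_framed_int k c d : d != 0 ->
  Nf k c d * 2 * \prod_(j < k) T d j.+1 =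
  \prod_(j < k) S (c.+1 + j) 1 * S c d :> int.
Proof.
move=> d0; have /(congr1 (fun n => n%:R : int)) := card_framed (k + c) k d0.
rewrite (card_frames_self two_neq0) // (card_frames_diag_disc two_neq0).
by rewrite !natrM !natr_prod => <-; ring.
Qed.

(** The index is shifted as in [diag_disc]: the subspaces counted have dimension
    k.+1, in a space of dimension k + c. *)
Definition framed_count k c : int := Nf k c 1 + Nf k c nu.

Lemma qprod_neq0 r : qprod Q r 0 != 0.
Proof.
apply/prodf_neq0 => j _; rewrite subr_eq0 -natrX -[1]/(1%:R) eqr_nat.
rewrite -[X in _ != X](exp1n (0 + j).+1.*2) eqn_exp2r //.
rewrite neq_ltn; apply/orP; right; apply: card_finRing_gt1.
Qed.

Lemma norm_count_odd_nu s : S s.*2.+1 nu = Q ^+ s * (Q ^+ s - 1).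
Proof. by rewrite (norm_count_odd two_neq0 iP) (sqrt_count_nonsquare nuP) addr0. Qed.

Lemma pairprod_to_qprod r s (N C : int) :
  N * pairprod r 0 = C * pairprod r s ->
  N * qprod Q r 0 = C * Q ^+ (2 * r * s) * qprod Q r s.
Proof.
rewrite !pairprodE muln0 addn0 exprD => eqN.
apply: (mulfI (expf_neq0 (r * r)%N Q_neq0)).
by rewrite mulrCA eqN; ring.
Qed.

Let nu0 := nu_neq0 nuP.
Let one0 := oner_neq0 F.

Lemma int2_neq0 : 2 != 0 :> int. Proof. by []. Qed.

(** When the dimension of the subspaces is odd, the two types have the same
    denominator, and only the numbers of choices for the last row of a frame
    are added. *)
Lemma framed_count_odd_odd r s :
  framed_count r.*2 s.*2.+1 * qprod Q r 0 =
  Q ^+ s.*2 * Q ^+ (2 * r * s) * qprod Q r s.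
Proof.
apply: pairprod_to_qprod; apply: (mulfI int2_neq0).
have := card_framed_int r.*2 s.*2.+1 one0.
have := card_framed_int r.*2 s.*2.+1 nu0.
rewrite prod_unit_count1 (prod_norm_count r 0) prod_unit_count_nu prod_norm_count.
have -> : Q ^+ s.*2 = Q ^+ s * Q ^+ s by rewrite -exprD addnn.
rewrite norm_count_odd1 norm_count_odd_nu /framed_count => e1 e2.
transitivity (Nf r.*2 s.*2.+1 1 * 2 * pairprod r 0 +
   Nf r.*2 s.*2.+1 nu * 2 * pairprod r 0); first by ring.
by rewrite e1 e2; ring.
Qed.

Lemma shift_prod k s :
  S s.*2.+2 1 * \prod_(j < k) S (s.*2.+3 + j) 1 =
  \prod_(j < k.+1) S (s.*2.+2 + j) 1.
Proof.
rewrite [RHS]big_ord_recl /= addn0; congr (_ * _); apply: eq_bigr => j _.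
by rewrite /bump /= add1n addnS.
Qed.

Lemma framed_count_odd_even r s :
  framed_count r.*2 s.*2.+2 * qprod Q r 0 =
  Q ^+ (s + r) * (Q ^+ (s + r).+1 - 1) * Q ^+ (2 * r * s) * qprod Q r s.
Proof.
apply: pairprod_to_qprod; apply: (mulfI int2_neq0).
have := card_framed_int r.*2 s.*2.+2 one0.
have := card_framed_int r.*2 s.*2.+2 nu0.
rewrite prod_unit_count1 (prod_norm_count r 0) prod_unit_count_nu.
have -> : S s.*2.+2 nu = S s.*2.+2 1 by rewrite !(norm_count_even two_neq0 iP).
rewrite [_ * S s.*2.+2 1]mulrC shift_prod big_ord_recr /= prod_norm_count.
have -> : (s.*2.+2 + r.*2 = (s + r).*2.+2)%N by lia.
rewrite (norm_count_even two_neq0 iP) // /framed_count => e1 e2.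
transitivity (Nf r.*2 s.*2.+2 1 * 2 * pairprod r 0 +
   Nf r.*2 s.*2.+2 nu * 2 * pairprod r 0); first by ring.
by rewrite e1 e2; ring.
Qed.

(** When the dimension of the subspaces is even, the denominators of the two
    types differ: one has the factor q^(r+1) - 1 where the other has
    q^(r+1) + 1. *)
Lemma framed_count_even_even r s :
  framed_count r.*2.+1 s.*2.+1 * qprod Q r.+1 0 =
  Q ^+ (2 * r.+1 * s) * qprod Q r.+1 s.
Proof.
rewrite -[RHS]mul1r mulrA; apply: pairprod_to_qprod; apply: (mulfI int2_neq0).
have := card_framed_int r.*2.+1 s.*2.+1 one0.
have := card_framed_int r.*2.+1 s.*2.+1 nu0.
rewrite /framed_count; move: (Nf _ _ 1) (Nf _ _ nu) => N1 N2.
rewrite prod_unit_count1 ![\prod_(_ < r.*2.+1) _]big_ord_recr /=.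
rewrite (prod_norm_count r 0) prod_unit_count_nu prod_norm_count.
have -> : (s.*2.+2 + r.*2 = (s + r).*2.+2)%N by lia.
rewrite -[(2 + r.*2)%N]/(r.*2.+2) !(norm_count_even two_neq0 iP) //.
rewrite (unit_count_nu_odd two_neq0 iP nuP) norm_count_odd1 norm_count_odd_nu.
rewrite !pairprodS !add0n.
have expr_double m : Q ^+ m.*2 = Q ^+ m * Q ^+ m by rewrite -exprD addnn.
rewrite !doubleS !exprS !expr_double !exprD.
move: Q => x e2 e1; pose a := x ^+ r.
(* Each type is multiplied by what its denominator lacks. *)
transitivity
  (N1 * 2 * (pairprod r 0 * (a * (x * a - 1))) * (x * a * (x * a + 1)) +
   N2 * 2 * (pairprod r 0 * (a * (x * a + 1))) * (x * a * (x * a - 1))).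
  by rewrite /a; ring.
by rewrite e1 e2 /a; ring.
Qed.

Lemma framed_count_even_odd r s :
  framed_count r.*2.+1 s.*2.+2 * qprod Q r.+1 0 =
  Q ^+ r.+1.*2 * Q ^+ (2 * r.+1 * s) * qprod Q r.+1 s.
Proof.
apply: pairprod_to_qprod; apply: (mulfI int2_neq0).
have := card_framed_int r.*2.+1 s.*2.+2 one0.
have := card_framed_int r.*2.+1 s.*2.+2 nu0.
rewrite /framed_count; move: (Nf _ _ 1) (Nf _ _ nu) => N1 N2.
have -> : S s.*2.+2 nu = S s.*2.+2 1 by rewrite !(norm_count_even two_neq0 iP).
rewrite [_ * S s.*2.+2 1]mulrC shift_prod (prod_norm_count r.+1).
rewrite prod_unit_count1 ![\prod_(_ < r.*2.+1) _]big_ord_recr /=.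
rewrite (prod_norm_count r 0) prod_unit_count_nu.
rewrite -[(2 + r.*2)%N]/(r.*2.+2) (norm_count_even two_neq0 iP) //.
rewrite (unit_count_nu_odd two_neq0 iP nuP) (pairprodS r 0) !add0n.
have expr_double m : Q ^+ m.*2 = Q ^+ m * Q ^+ m by rewrite -exprD addnn.
rewrite !doubleS !exprS !expr_double.
move: Q (pairprod r.+1 s) => x V e2 e1; pose a := x ^+ r.
(* Each type is multiplied by what its denominator lacks. *)
transitivity
  (N1 * 2 * (pairprod r 0 * (a * (x * a - 1))) * (x * a * (x * a + 1)) +
   N2 * 2 * (pairprod r 0 * (a * (x * a + 1))) * (x * a * (x * a - 1))).
  by rewrite /a; ring.
by rewrite e1 e2 /a; ring.
Qed.

End Products.

Lemma size_monic_qprod r s :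
  size (qprod ('X : {poly int}) r s) = (2 * r * s + r * r + r).+1 /\
  qprod ('X : {poly int}) r s \is monic.
Proof.
elim: r => [|r [IH mon]].
  by rewrite /qprod big_ord0 size_poly1 muln0 mul0n monic1.
rewrite qprodS; have n0 : (0 < (s + r).+1.*2)%N by rewrite doubleS.
have := monicXnsubC (1 : int) n0; have := size_XnsubC (1 : int) n0.
rewrite polyC1 => sz mon'; split; last by rewrite monicMl.
rewrite size_monicM ?monic_neq0 // IH sz; lia.
Qed.

Lemma horner_qprod r s (x : int) : (qprod 'X r s).[x] = qprod x r s.
Proof.
rewrite /qprod horner_prod; apply: eq_bigr => j _.
by rewrite !hornerE ?hornerXn.
Qed.

Lemma size_of_qprod_quotient (p : {poly int}) (T : {poly int}) r s d :
  p * qprod 'X r 0 = T * qprod 'X r s -> size T = d.+1 ->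
  (size p).-1 = (2 * r * s + d)%N.
Proof.
move=> eqp szT; have [sz0 mon0] := size_monic_qprod r 0.
have [sz mon] := size_monic_qprod r s.
have T0 : T != 0 by rewrite -size_poly_gt0 szT.
have p0 : p != 0.
  apply: contraNneq (mulf_neq0 T0 (monic_neq0 mon)) => p0.
  by rewrite -eqp p0 mul0r.
have e : ((size p + size (qprod ('X : {poly int}) r 0)).-1 =
          (size T + size (qprod ('X : {poly int}) r s)).-1)%N.
  by rewrite -!size_mul ?(monic_neq0 mon0) ?(monic_neq0 mon) // eqp.
rewrite sz sz0 szT in e.
have := size_poly_gt0 p; rewrite p0; lia.
Qed.

(** The quotient [qprod x r s] / [qprod x r 0] is shared by the count N and by
    p(x), and can be cancelled.  M plays the part of k (n - k); since p has
    degree 2 r s + d, the power M - D is 2 r s + g. *)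
Lemma count_of_qprod_identities (N x : int) (p T : {poly int}) r s d e g :
  p * qprod 'X r 0 = T * qprod 'X r s -> size T = d.+1 ->
  qprod x r 0 != 0 ->
  N * qprod x r 0 = e * x ^+ (2 * r * s) * qprod x r s ->
  (T.[x] * x ^+ g = e) \/ (T.[x] * x ^+ g = - e) ->
  let D := (size p).-1 in forall M, (M = 2 * (2 * r * s) + d + g)%N ->
  N = x ^+ (M - D) * p.[x] \/ N = - (x ^+ (M - D) * p.[x]).
Proof.
move=> eqp szT q0 eqN eT D M ->.
have -> : (2 * (2 * r * s) + d + g - D = 2 * r * s + g)%N.
  by rewrite /D (size_of_qprod_quotient eqp szT); lia.
have := congr1 (horner^~ x) eqp; rewrite !hornerM !horner_qprod => px.
case: eT => eT; [left|right]; apply: (mulIf q0).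
  by rewrite eqN -[RHS]mulrA px -eT exprD; ring.
by rewrite eqN mulNr -[X in - X]mulrA px -[e]opprK -eT exprD; ring.
Qed.

Theorem proposition8p5 (k n : nat) (hk1 : (1 <= k)%N) (hkn : (k <= n - 1)%N)
    (p m q : nat) (hp : prime p) (hodd : odd p) (hm : (0 < m)%N)
    (hq : q = (p ^ m)%N)
    (F : finFieldType) (hF : #|F| = q) (hi : exists i : F, i ^+ 2 = -1)
    (K : closedFieldType) (iota : {rmorphism F -> K})
    (hK : integralRange iota) :
  let D := (size (p_poly k n)).-1 in
  let N := (q%:R : int) ^+ (k * (n - k) - D) * (p_poly k n).[q%:R] in
  #|Gr_points iota k n|%:R = N \/ #|Gr_points iota k n|%:R = - N.
Proof.
have [i iP] := hi.
(* Translation by 1 permutes F, so the order of F, which is odd, is 0 in F. *)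
have two_neq0 : 2%:R != 0 :> F.
  apply/eqP => two0; have : (#|F|)%:R = 0 :> F.
    have /eqP : \sum_(x : F) x = \sum_(x : F) (x + 1).
      exact: (reindex_inj (addIr (1 : F))).
    rewrite big_split /= sumr_const -[X in X == _]addr0 (inj_eq (addrI _)).
    by move/eqP=> <-.
  move/eqP; rewrite hF hq -(odd_double_half (p ^ m)) oddX hodd orbT.
  by rewrite natrD -mul2n natrM two0 mul0r addr0 oner_eq0.
have [nu nuP] := nonsquare_exists two_neq0.
(* From here on the subspaces have dimension k.+1. *)
case: k hk1 hkn => // k _ hkn.
have [c nE] : exists c, (n = k + c.+2)%N by exists (n - k - 2)%N; lia.
have NE : #|Gr_points iota k.+1 n|%:R = framed_count nu k c.+2 :> int.
  rewrite (Gr_points_framed two_neq0 iP nuP); last by lia.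
  rewrite cardsU (disjoint_setI0 (framed_disjoint nuP n k)) cards0 subn0 natrD.
  by rewrite nE.
move=> D N; rewrite NE {}/N {}/D -hF.
have Q0 r := qprod_neq0 F r.
have split a : exists b : bool, exists h, a = (b + h.*2)%N.
  by exists (odd a), a./2; rewrite odd_double_half.
have [[] [r kE]] := split k; have [[] [s cE]] := split c;
  rewrite {}nE {}kE {}cE ?add0n ?add1n.
- rewrite -[s.*2.+3]/(s.+1.*2.+1) -[r.*2.+2]/(r.+1.*2).
  have -> : (r.*2.+1 + s.+1.*2.+1 = (s.+1 + r.+1).*2)%N by lia.
  apply: (count_of_qprod_identities (T := 1) (r := r.+1) (s := s.+1)
    (d := 0) (g := 0) (e := 1)).
  + by rewrite (p_poly_even r.+1 s.+1 false) mul1r.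
  + exact: size_poly1.
  + exact: Q0.
  + by rewrite (framed_count_even_even two_neq0 iP nuP) mul1r.
  + by left; rewrite hornerC mulr1.
  by rewrite (_ : ((s.+1 + r.+1).*2 - r.+1.*2 = s.+1.*2)%N); lia.
- rewrite -[r.*2.+2]/(r.+1.*2).
  have -> : (r.*2.+1 + s.*2.+2 = true + (s + r.+1).*2)%N by lia.
  apply: (count_of_qprod_identities (T := 1) (r := r.+1) (s := s)
    (d := 0) (g := r.+1.*2)).
  + by rewrite p_poly_even mul1r.
  + exact: size_poly1.
  + exact: Q0.
  + exact: (framed_count_even_odd two_neq0 iP nuP).
  + by left; rewrite hornerC mul1r.
  by rewrite (_ : (true + (s + r.+1).*2 - r.+1.*2 = s.*2.+1)%N); lia.
- rewrite -[s.*2.+3]/(s.+1.*2.+1).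
  have -> : (r.*2 + s.+1.*2.+1 = (s.+1 + r).*2.+1)%N by lia.
  apply: (count_of_qprod_identities (T := 1) (r := r) (s := s.+1)
    (d := 0) (g := s.+1.*2)).
  + by rewrite p_poly_odd_odd mul1r.
  + exact: size_poly1.
  + exact: Q0.
  + exact: (framed_count_odd_odd two_neq0 iP nuP).
  + by left; rewrite hornerC mul1r.
  by rewrite (_ : ((s.+1 + r).*2.+1 - r.*2.+1 = s.+1.*2)%N); lia.
have -> : (r.*2 + s.*2.+2 = (s + r).*2.+2)%N by lia.
apply: (count_of_qprod_identities (T := 1 - 'X^((s + r).+1)) (r := r) (s := s)
    (d := (s + r).+1) (g := (s + r)%N)).
- exact: p_poly_odd_even.
- by rewrite -opprB size_polyN -polyC1 size_XnsubC.
- exact: Q0.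
- exact: (framed_count_odd_even two_neq0 iP nuP).
- by right; rewrite !hornerE; ring.
by rewrite (_ : ((s + r).*2.+2 - r.*2.+1 = s.*2.+1)%N); lia.
Qed.
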